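(* Let $\{(G_n,\mathcal M(G_n))\}_{n\ge1}$ be finite (random) marked networks, $G_n$ having vertex set $[n]$, with empirical rooted laws $\mathcal P_n$. Assume either the contractive hypotheses (I) or the nonexpansive hypotheses (II) listed in the context, together with the bounded risk domain assumption listed in the context. In case (II), let $x^\star(n)$ be any measurable finite-network equilibrium selection; in case (I), $x^\star(n)$ is the unique equilibrium. Let $$\eta_n=\frac1n\sum_{i=1}^n\delta_{\ell_{\tau_i(n)}(x_i^\star(n))},\qquad \eta=\operatorname{Law}\bigl(\ell_{\tau_o}(x_o^\star)\bigr).$$ Then $\eta_n\overset{\mathbb P}{\Rightarrow}\eta$. If moreover the weak continuity assumption on the law functional $\varrho$ listed in the context holds, then $$\varrho(\eta_n)\xrightarrow{\mathbb P}\varrho(\eta)=\rho(Y_o),\qquad Y_o:=\ell_{\tau_o}(x_o^\star).$$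
   Context: **Marks.** $\mathcal T$ is a Polish space (of types) with a complete compatible metric. For a fixed $L\in[0,1)$, $\mathsf F_{\mathrm c}$ is the set of continuous nondecreasing $f:\mathbb R\to\mathbb R$ with $f(0)=0$ and Lipschitz constant at most $L$, with metric $d_{\mathrm c}(f,g)=\sum_{q\ge1}2^{-q}\bigl(1\wedge\sup_{|z|\le q}|f(z)-g(z)|\bigr)$. $\mathsf F_{\mathrm{ne}}$ is the set of bounded, nonnegative, nondecreasing, $1$-Lipschitz $f:\mathbb R\to\mathbb R$ with metric $\|f-g\|_\infty$, and $\mathfrak b(f):=\sup_zf(z)$. The vertex-mark space is $\mathsf M^V=\mathcal T\times\mathbb R\times\mathsf F_{\mathrm c}$ in the contractive regime and $\mathsf M^V=\mathcal T\times\mathbb R\times\mathsf F_{\mathrm{ne}}$ in the nonexpansive regime, with a complete product metric $d_{\mathsf M^V}$; a vertex $v$ has mark $m_v=(\tau_v,\epsilon_v,f_v)$ (type, shock, response). The edge-mark space is $\mathsf M^E=(0,\infty)$ with $d_{\mathsf M^E}(c,c')=|\log c-\log c'|$; an edge $(v,u)$ has mark $C_{vu}>0$. **Rooted marked graphs and local topology.** A directed graph $G=(V,E)$ is forward locally finite if every vertex has finite out-degree. A rooted marked directed graph $(G,o,\mathcal M(G))$ is such a graph with a root $o\in V$ and marks $m_v\in\mathsf M^V$, $m_e\in\mathsf M^E$. An isomorphism is a vertex bijection preserving edges in both directions, the root, and all marks; $\mathcal G_*$ is the set of isomorphism classes. Let $d_G^+(o,v)$ be the length of a shortest directed path from $o$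 to $v$ ($\infty$ if none), $V_k^+(o)=\{v:d_G^+(o,v)\le k\}$ and $E_k^+(o)=\{(v,u)\in E:d_G^+(o,v)<k\}$. For $\xi=[G,o,\mathcal M(G)]$, $[\xi]_k$ is the isomorphism class of the rooted marked graph with vertex set $V_k^+(o)$, edge set $E_k^+(o)$ and the original marks; $\mathfrak X_k$ is the set of such classes. Put $d_V=1\wedge d_{\mathsf M^V}$, $d_E=1\wedge d_{\mathsf M^E}$. For $a,b\in\mathfrak X_r$ let $d_r(a,b)=1$ if there is no root-preserving isomorphism of the underlying directed graphs (ignoring marks), and otherwise $d_r(a,b)=\min_\phi\max\{\max_v d_V(m_v,m'_{\phi(v)}),\max_{(v,u)}d_E(m_{(v,u)},m'_{(\phi(v),\phi(u))})\}$ over such isomorphisms $\phi$ (an empty maximum is $0$). Set $d_{\mathrm{loc}}(\xi,\xi')=\sum_{r\ge0}2^{-r-1}d_r([\xi]_r,[\xi']_r)$, and let $\widetilde{\mathcal G}_*$ be the quotient of $\mathcal G_*$ by $\{d_{\mathrm{loc}}=0\}$, a Polish space with metric $d_{\mathrm{loc}}$. **Convergence.** $\mathcal P_n=\frac1n\sum_{i=1}^n\delta_{[G_n,i,\mathcal M(G_n)]}$. For random probability measures $\nu_n$ and a deterministic $\nu$ on a Polish space, $\nu_n\overset{\mathbb P}{\Rightarrow}\nu$ means $\int h\,d\nu_n\to\int h\,d\nu$ in probability for every bounded continuous $h$. **Weights, equilibria, limit.** $W_{vu}=C_{vu}/\sum_{w:(v,w)\in E}C_{vw}$ for an edge, and $0$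 otherwise (vertices without outgoing edges have zero network input). On $G_n$ write $W_{ij}(n),\tau_i(n),\epsilon_i(n),f_i$, $\epsilon(n)=(\epsilon_i(n))_i$. An equilibrium of the finite network satisfies $x_i=f_i\bigl(\sum_jW_{ij}(n)x_j+\epsilon_i(n)\bigr)$, $i\in[n]$. $(G,o,\mathcal M(G))$ denotes a random rooted network with the limit law $\mathcal P$, $G$ being the root's forward component, $V(G)=\bigcup_rV_r^+(o)$. The update on it is $(T_Gz)_v=f_v\bigl(\sum_{u:(v,u)\in E(G)}W_{vu}z_u+\epsilon_v\bigr)$. **Hypotheses (I), contractive regime.** (A1) Every finite-network response lies in $\mathsf F_{\mathrm c}$ for a common $L\in[0,1)$, and the same holds $\mathcal P$-a.s. at every vertex of the limiting forward component; (A2) $\sup_n\mathbb E[\|\epsilon(n)\|_\infty]<\infty$; (A3) $\mathcal P_n\overset{\mathbb P}{\Rightarrow}\mathcal P$ for a deterministic $\mathcal P$. In this case $x^\star(n)$ is the unique finite equilibrium and $x_o^\star$ is the root coordinate of the a.s. unique bounded fixed point of $T_G$. **Hypotheses (II), nonexpansive regime.** (B1) $\mathcal P_n\overset{\mathbb P}{\Rightarrow}\mathcal P$ for a deterministic $\mathcal P$; (B2) every finite-network response lies in $\mathsf F_{\mathrm{ne}}$, and the same holds $\mathcal P$-a.s. at every vertex of the limiting forward component; (B3) with $x_v^{-,0}=0$, $x_v^{+,0}=\mathfrak b(f_v)$, $x^{\pm,k+1}=T_G(x^{\pm,k})$, one has $x_o^{+,k}-x_o^{-,k}\to0$ a.s.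 In this case $x_o^\star$ is the common a.s. limit of $x_o^{\pm,k}$. **Bounded risk domain assumption.** In the contractive regime: there are deterministic nonnegative bounds $(\bar\epsilon_t)_{t\in\mathcal T}$, measurable in $t$, with $\bar\epsilon:=\sup_t\bar\epsilon_t<\infty$, such that a.s. $|\epsilon_i(n)|\le\bar\epsilon_{\tau_i(n)}$ for all $n,i$ and $|\epsilon_v|\le\bar\epsilon_{\tau_v}$ for all limiting vertices $v$; put $K_x=[-\bar\epsilon/(1-L),\bar\epsilon/(1-L)]$. In the nonexpansive regime: there is a deterministic $B_*<\infty$ with, a.s., $\mathfrak b(f_i)\le B_*$ and $\mathfrak b(f_v)\le B_*$ for all finite and limiting vertices; put $K_x=[0,B_*]$. In both: the loss map $\ell:\mathcal T\times\mathbb R\to\mathbb R$, $\ell(t,z)=\ell_t(z)$, is jointly continuous and uniformly bounded on $\mathcal T\times K_x$. $K_\ell$ is a compact interval containing $\ell(\mathcal T\times K_x)$; $\mathscr P(K_\ell)$ has the weak topology. **Risk functionals.** $L^\infty$ is taken on an atomless probability space. $\rho:L^\infty\to\mathbb R$ is law invariant ($X\stackrel d=Y$ implies $\rho(X)=\rho(Y)$), with law representation $\varrho:\mathcal D\to\mathbb R$, $\rho(Z)=\varrho(\operatorname{Law}(Z))$, on a class $\mathcal D\subseteq\mathscr P(K_\ell)$ containing the loss laws considered. **Weak continuity assumption.** $\eta_n\in\mathcal D$ a.s., $\eta\in\mathcal D$, $\varrho$ is continuous at $\eta$ under weak convergence on $\mathcal D$, and the quantities $\varrho(\eta_n)$ are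 measurable. *)

(* Defs.v *)
From HB Require Import structures.
From mathcomp Require Import all_boot all_order all_algebra.
From mathcomp Require Import ring lra.
From mathcomp Require Import all_classical all_reals all_analysis.
Set Implicit Arguments.
Unset Strict Implicit.
Unset Printing Implicit Defensive.
Import Order.TTheory GRing.Theory Num.Theory.
Import numFieldNormedType.Exports.
Local Open Scope classical_set_scope.
Local Open Scope ring_scope.

HB.mixin Record isSeparable T & Topological T := {
  separable_subproof : exists2 D : set T, countable D & dense D
}.

(* Nonempty Polish spaces, with a complete compatible metric [mdist]. *)
#[short(type="polishType")]
HB.structure Definition Polish (R : realType) :=
  {T of Metric R T & Complete T & isSeparable T}.

Definition Borel (X : ptopologicalType) := g_sigma_algebraType (@open X).
HB.instance Definition _ (X : ptopologicalType) := Measurable.on (Borel X).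

Definition bcontinuous (R : realType) (X : topologicalType) : set (X -> R) :=
  [set h | continuous h /\ exists M, forall x, `|h x| <= M].
Arguments bcontinuous R X : clear implicits.

Section weighted_sum.
Context {R : realType}.
Implicit Types u v : nat -> R.

Definition wsum u : R := limn (series (fun k => 2%:R ^- k.+1 * u k)).

Let c (k : nat) : R := 2%:R ^- k.+1.

Let c_gt0 k : 0 < c k. Proof. by rewrite invr_gt0 exprn_gt0. Qed.

Let cvg_c : cvgn (series c).
Proof.
have -> : c = geometric (2^-1) (2^-1).
  by apply/funext => k; rewrite /c/= -exprVn exprS.
by apply: is_cvg_geometric_series; rewrite gtr0_norm ?invf_lt1 ?ltr1n ?invr_gt0.
Qed.

Lemma is_cvg_wsum u : (forall k, 0 <= u k <= 1) ->
  cvgn (series (fun k => c k * u k)).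
Proof.
move=> u01; apply: (@series_le_cvg _ _ c) => // k.
- by rewrite mulr_ge0 ?(ltW (c_gt0 _))//; case/andP: (u01 k).
- exact: ltW.
- by rewrite ler_piMr ?(ltW (c_gt0 _))//; case/andP: (u01 k).
Qed.

Lemma wsum_triangle u v w : (forall k, 0 <= u k <= 1) ->
  (forall k, 0 <= v k <= 1) -> (forall k, 0 <= w k <= 1) ->
  (forall k, u k <= v k + w k) -> wsum u <= wsum v + wsum w.
Proof.
move=> u01 v01 w01 uvw; rewrite /wsum.
have cu := is_cvg_wsum u01; have cv := is_cvg_wsum v01.
have cw := is_cvg_wsum w01.
rewrite -(limD cv cw); apply: ler_lim => //; first exact: is_cvgD.
apply: nearW => n; rewrite fctE /series/= -big_split/=.
by apply: ler_sum => k _; rewrite -mulrDr ler_wpM2l ?(ltW (c_gt0 _)).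
Qed.

Lemma wsum0 u : (forall k, u k = 0) -> wsum u = 0.
Proof.
move=> u0; rewrite /wsum.
rewrite (_ : series _ = cst 0) ?lim_cst//; apply/funext => n.
by rewrite /series/= big1// => k _; rewrite u0 mulr0.
Qed.

Lemma wsum_eq0 u : (forall k, 0 <= u k <= 1) -> wsum u = 0 ->
  forall k, u k = 0.
Proof.
move=> u01 u0 k; have /andP[uk0 _] := u01 k.
have cuk : c k * u k <= wsum u.
  apply: limr_ge; first exact: (is_cvg_wsum u01).
  near=> n; have kn : (k < n)%N by near: n; exact: nbhs_infty_gt.
  rewrite /series/= big_mkord (bigD1 (Ordinal kn))//= lerDl sumr_ge0// => i _.
  by rewrite mulr_ge0 ?(ltW (c_gt0 _))//; case/andP: (u01 i).
apply/eqP; rewrite eq_le uk0 andbT -(pmulr_rle0 _ (c_gt0 k)).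
by rewrite -u0.
Unshelve. all: by end_near. Qed.

End weighted_sum.

Definition disk (R : realType) (q : R) : set R := [set z | `|z| <= q].

Section sup_distance.
Context {R : realType}.
Implicit Types (A : set R) (f g h : R -> R).

Definition sup_dist A f g : R := sup [set `|f z - g z| | z in A].

Definition bounded_on A f := exists M, forall z, A z -> `|f z| <= M.

Let has_sup_dist A f g : A !=set0 -> bounded_on A f -> bounded_on A g ->
  has_sup [set `|f z - g z| | z in A].
Proof.
move=> [a Aa] [M fM] [N gN]; split; first by exists `|f a - g a|, a.
exists (M + N) => _ [z Az <-].
by rewrite (le_trans (ler_normB _ _))// lerD ?fM ?gN.
Qed.

Lemma sup_dist_ub A f g z : bounded_on A f -> bounded_on A g -> A z ->
  `|f z - g z| <= sup_dist A f g.
Proof.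
move=> bf bg Az; apply: sup_upper_bound; last by exists z.
by apply: has_sup_dist => //; exists z.
Qed.

Lemma sup_dist_ge0 A f g : A !=set0 -> bounded_on A f -> bounded_on A g ->
  0 <= sup_dist A f g.
Proof. by move=> [a Aa] bf bg; exact: le_trans (sup_dist_ub bf bg Aa). Qed.

Lemma sup_dist_sym A f g : sup_dist A f g = sup_dist A g f.
Proof.
by rewrite /sup_dist; congr sup; apply/seteqP; split => [_ [z Az <-]|_ [z Az <-]];
  exists z => //; rewrite distrC.
Qed.

Lemma sup_distxx A f : A !=set0 -> sup_dist A f f = 0.
Proof.
move=> [a Aa]; rewrite /sup_dist (_ : [set _ | _ in _] = [set 0]) ?sup1//.
apply/seteqP; split => [_ [z Az <-]|_ ->]; first by rewrite subrr normr0.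
by exists a => //; rewrite subrr normr0.
Qed.

Lemma sup_dist_triangle A f g h : A !=set0 -> bounded_on A f ->
  bounded_on A g -> bounded_on A h ->
  sup_dist A f h <= sup_dist A f g + sup_dist A g h.
Proof.
move=> A0 bf bg bh; have [[x Sx] _] := has_sup_dist A0 bf bh.
apply: sup_le_ub; first by exists x.
move=> _ [z Az <-]; rewrite (le_trans (ler_distD (g z) _ _))//.
by rewrite lerD// sup_dist_ub.
Qed.

End sup_distance.

Lemma min1_triangle (R : realType) (a b c : R) : 0 <= b -> 0 <= c -> a <= b + c ->
  Num.min 1 a <= Num.min 1 b + Num.min 1 c.
Proof. by move=> b0 c0 abc; rewrite /Num.min; do ?case: ifP; lra. Qed.

Lemma min1_itv (R : realType) (a : R) : 0 <= a -> 0 <= Num.min 1 a <= 1.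
Proof. by move=> a0; rewrite /Num.min; case: ifP; lra. Qed.

Variant regime (R : realType) := Contractive (L : R) of 0 <= L < 1 | Nonexpansive.
Arguments Nonexpansive {R}.

(* F_c for [Contractive L _], F_ne for [Nonexpansive]. *)
Definition is_response (R : realType) (reg : regime R) (f : R -> R) : Prop :=
  match reg with
  | Contractive L _ => [/\ continuous f, {homo f : x y / x <= y}, f 0 = 0 &
      forall x y, `|f x - f y| <= L * `|x - y|]
  | Nonexpansive => [/\ exists B, forall z, f z <= B, forall z, 0 <= f z,
      {homo f : x y / x <= y} & forall x y, `|f x - f y| <= `|x - y|]
  end.

Record response (R : realType) (reg : regime R) := Response {
  response_fun :> R -> R ;
  responseP : is_response reg response_fun }.

Definition response_dist (R : realType) (reg : regime R) (f g : response reg) : R :=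
  match reg with
  | Contractive _ _ =>
      wsum (fun k => Num.min 1 (sup_dist (disk k.+1%:R) f g))
  | Nonexpansive => sup_dist setT f g
  end.

Section response_metric.
Context {R : realType} (reg : regime R).
Implicit Types f g h : response reg.

HB.instance Definition _ := gen_eqMixin (response reg).
HB.instance Definition _ := gen_choiceMixin (response reg).

Let response0_proof : is_response reg (cst 0).
Proof.
case: reg => [L L01|]; first have /andP[L0 _] := L01; split => //=.
- by move=> x; exact: cvg_cst.
- by move=> x y; rewrite subrr normr0 mulr_ge0.
- by exists 0.
- by move=> x y; rewrite subrr normr0.
Qed.

HB.instance Definition _ := isPointed.Build (response reg) (Response response0_proof).

Lemma response_inj f g : f =1 g -> f = g.
Proof.
destruct f as [f Pf], g as [g Pg] => /= fg.
have {fg} ? : f = g by apply: funext.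
by subst g; congr Response; exact: Prop_irrelevance.
Qed.

End response_metric.

Lemma response_bounded_disk (R : realType) (L : R) (L01 : 0 <= L < 1)
    (f : response (Contractive L01)) (q : R) :
  bounded_on (disk q) f.
Proof.
have [_ _ f0 fL] := responseP f; exists (L * q) => z /= zq.
have := fL z 0; rewrite f0 !subr0 => /le_trans; apply.
by have /andP[L0 _] := L01; rewrite ler_wpM2l.
Qed.

Lemma response_bounded (R : realType) (f : response (@Nonexpansive R)) :
  bounded_on setT f.
Proof.
by have [[B fB] f0 _ _] := responseP f; exists B => z _; rewrite ger0_norm.
Qed.

Section response_metric_instance.
Context {R : realType} (reg : regime R).
Implicit Types f g h : response reg.

Let disk0 (k : nat) : disk (k.+1%:R : R) !=set0.
Proof. by exists 0; rewrite /disk/= normr0. Qed.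

Let setT0 : [set: R] !=set0. Proof. by exists 0. Qed.

Let dist_xx f : response_dist f f = 0.
Proof.
rewrite /response_dist; case: reg f => [L L01|] f; last exact: sup_distxx.
by apply: wsum0 => k; rewrite sup_distxx// /Num.min; case: ifP => //; lra.
Qed.

Let dist_eq0 f g : response_dist f g = 0 -> f = g.
Proof.
rewrite /response_dist; case: reg f g => [L L01|] f g d0; apply: response_inj => z.
- have /wsum_eq0 : forall k, 0 <= Num.min 1 (sup_dist (disk k.+1%:R) f g) <= 1.
    move=> k; apply/min1_itv/sup_dist_ge0 => //; exact: response_bounded_disk.
  move=> /(_ d0 (Num.truncn `|z|)) sup0.
  have zq : `|z| <= (Num.truncn `|z|).+1%:R by rewrite ltW// truncnS_gt.
  have := @sup_dist_ub _ (disk (Num.truncn `|z|).+1%:R) f g z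
    (response_bounded_disk f _) (response_bounded_disk g _) zq.
  move: sup0; set s := sup_dist _ _ _ => s0 fgs.
  have {s0} s0 : s <= 0 by move: s0; rewrite /Num.min; case: ifP; lra.
  apply/eqP; rewrite -subr_eq0 -normr_le0; exact: le_trans fgs s0.
- apply/eqP; rewrite -subr_eq0 -normr_le0 -d0.
  exact: (sup_dist_ub (response_bounded f) (response_bounded g)).
Qed.

Let dist_sym f g : response_dist f g = response_dist g f.
Proof.
rewrite /response_dist; case: reg f g => [L L01|] f g; last exact: sup_dist_sym.
by congr wsum; apply/funext => k; rewrite sup_dist_sym.
Qed.

Let dist_triangle g f h :
  response_dist f h <= response_dist f g + response_dist g h.
Proof.
rewrite /response_dist; case: reg f g h => [L L01|] f g h; last first.
  by apply: sup_dist_triangle => //; exact: response_bounded.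
have B (f' : response (Contractive L01)) k := response_bounded_disk f' k.+1%:R.
apply: wsum_triangle => k; last first.
  by apply: min1_triangle; [exact: sup_dist_ge0|exact: sup_dist_ge0|
    exact: sup_dist_triangle].
all: by apply/min1_itv/sup_dist_ge0.
Qed.

HB.instance Definition _ :=
  isMetric.Build R (response reg) dist_xx dist_eq0 dist_sym dist_triangle.

End response_metric_instance.

(* Marked directed graphs with finite out-degrees. [cap v u] is the mark C_vu of
   an edge (v, u); its values outside the edge set play no role. *)
Record mgraph (R : realType) (T : polishType R) (reg : regime R) (V : Type) := MGraph {
  edge : V -> V -> Prop ;
  vtype : V -> T ;
  shock : V -> R ;
  resp : V -> response reg ;
  cap : V -> V -> R ;
  finite_out : forall v, finite_set [set u | edge v u] ;
  cap_gt0 : forall v u, edge v u -> 0 < cap v u }.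

Record rgraph (R : realType) (T : polishType R) (reg : regime R) := RGraph {
  vertex : Type ;
  graph :> mgraph T reg vertex ;
  root : vertex }.

Section dynamics.
Context {R : realType} {T : polishType R} {reg : regime R} {V : Type}.
Variable G : mgraph T reg V.

Definition out (v : V) : set {classic V} := [set u | edge G v u].

Definition weight (v u : V) : R :=
  if `[< edge G v u >] then cap G v u / \sum_(w \in out v) cap G v w else 0.

Definition update (z : V -> R) (v : V) : R :=
  resp G v (\sum_(u \in out v) weight v u * z u + shock G v).

(* The iterates x^{-,k} and x^{+,k}; [sup (range f)] is b(f). *)
Definition lower_iter (k : nat) : V -> R := iter k update (cst 0).
Definition upper_iter (k : nat) : V -> R :=
  iter k update (fun v => sup (range (resp G v))).

(* [walk k v u]: there is a directed walk of length [k] from [v] to [u]. *)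
Fixpoint walk (k : nat) (v u : V) : Prop :=
  if k is k'.+1 then exists2 w, walk k' v w & edge G w u else v = u.

End dynamics.

Definition is_equilibrium (R : realType) (T : polishType R) (reg : regime R)
    (n : nat) (G : mgraph T reg 'I_n) (x : 'I_n -> R) : Prop :=
  forall i, x i = resp G i (\sum_j weight G i j * x j + shock G i).

Section local_distance.
Context {R : realType} {T : polishType R} {reg : regime R}.
Implicit Types G H K : rgraph T reg.

Definition ball_vertices G (r : nat) : set (vertex G) :=
  [set v | exists2 k, (k <= r)%N & walk G k (root G) v].

Definition ball_edges G (r : nat) : set (vertex G * vertex G) :=
  [set e | edge G e.1 e.2 /\ exists2 k, (k < r)%N & walk G k (root G) e.1].

(* The vertices reachable from the root, i.e. V(G) for a limiting network. *)
Definition forward G : set (vertex G) := [set v | exists k, walk G k (root G) v].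

Arguments ball_vertices G r : clear implicits.
Arguments ball_edges G r : clear implicits.
Arguments forward G : clear implicits.

(* The maximum is taken as the complete product metric on T x R x F. *)
Definition vmark_dist G H (v : vertex G) (w : vertex H) : R :=
  Num.max (mdist (vtype G v) (vtype H w))
    (Num.max `|shock G v - shock H w| (mdist (resp G v) (resp H w))).

Definition emark_dist (c c' : R) : R := `|ln c - ln c'|.

(* [phi] restricts to a root-preserving isomorphism between the underlying
   directed graphs of the truncations [G]_r and [H]_r. *)
Definition ball_iso (r : nat) G H (phi : vertex G -> vertex H) : Prop :=
  [/\ set_bij (ball_vertices G r) (ball_vertices H r) phi,
      phi (root G) = root H &
      forall v u, ball_vertices G r v -> ball_vertices G r u ->
        ball_edges G r (v, u) <-> ball_edges H r (phi v, phi u)].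

Definition iso_cost (r : nat) G H (phi : vertex G -> vertex H) : R :=
  sup ([set 0] `|`
    [set Num.min 1 (vmark_dist v (phi v)) | v in ball_vertices G r] `|`
    [set Num.min 1 (emark_dist (cap G e.1 e.2) (cap H (phi e.1) (phi e.2)))
      | e in ball_edges G r]).

Definition ball_dist (r : nat) G H : R :=
  if `[< exists phi, ball_iso r (G := G) (H := H) phi >]
  then inf [set iso_cost r phi | phi in [set phi | ball_iso r (G := G) (H := H) phi]]
  else 1.

Definition dloc G H : R := wsum (fun r => ball_dist r G H).

Lemma ball_root G r : ball_vertices G r (root G).
Proof. by exists 0%N. Qed.

Lemma ball_edges_l G r v u : ball_edges G r (v, u) -> ball_vertices G r v.
Proof. by move=> [_ [k kr w]]; exists k => //; exact: ltnW. Qed.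

Lemma ball_edges_r G r v u : ball_edges G r (v, u) -> ball_vertices G r u.
Proof. by move=> [e [k kr w]]; exists k.+1 => //; exists v. Qed.

Lemma vmark_dist_ge0 G H (v : vertex G) (w : vertex H) : 0 <= vmark_dist v w.
Proof. by rewrite /vmark_dist le_max mdist_ge0. Qed.

Lemma vmark_distxx G (v : vertex G) : vmark_dist v v = 0.
Proof. by rewrite /vmark_dist !mdistxx subrr normr0 !maxxx. Qed.

Lemma vmark_dist_sym G H (v : vertex G) (w : vertex H) :
  vmark_dist v w = vmark_dist w v.
Proof.
by rewrite /vmark_dist metric_sym distrC [mdist (resp _ _) _]metric_sym.
Qed.

Lemma vmark_dist_triangle G H K (v : vertex G) (w : vertex H) (u : vertex K) :
  vmark_dist v u <= vmark_dist v w + vmark_dist w u.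
Proof.
have t := metric_triangle (vtype G v) (vtype H w) (vtype K u).
have s := ler_distD (shock H w) (shock G v) (shock K u).
have f := metric_triangle (resp G v) (resp H w) (resp K u).
rewrite /vmark_dist !ge_max; apply/and3P; split.
- by apply: le_trans t _; rewrite lerD// le_max lexx.
- by apply: le_trans s _; rewrite lerD// !le_max lexx !orbT.
- by apply: le_trans f _; rewrite lerD// !le_max lexx !orbT.
Qed.

Lemma iso_cost_le r G H (phi : vertex G -> vertex H) (b : R) : 0 <= b ->
  (forall v, ball_vertices G r v -> Num.min 1 (vmark_dist v (phi v)) <= b) ->
  (forall v u, ball_edges G r (v, u) ->
    Num.min 1 (emark_dist (cap G v u) (cap H (phi v) (phi u))) <= b) ->
  iso_cost r phi <= b.
Proof.
move=> b0 vb eb; apply: sup_le_ub; first by exists 0; left; left.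
by move=> _ [[->//|[v rv <-]]|[[v u] re <-]]; [exact: vb|exact: eb].
Qed.

Lemma has_sup_iso_cost r G H (phi : vertex G -> vertex H) :
  has_sup ([set 0] `|`
    [set Num.min 1 (vmark_dist v (phi v)) | v in ball_vertices G r] `|`
    [set Num.min 1 (emark_dist (cap G e.1 e.2) (cap H (phi e.1) (phi e.2)))
      | e in ball_edges G r]).
Proof.
split; first by exists 0; left; left.
by exists 1 => _ [[->|[v rv <-]]|[[v u] re <-]]//; rewrite ge_min lexx.
Qed.

Lemma iso_cost_vertex r G H (phi : vertex G -> vertex H) v :
  ball_vertices G r v -> Num.min 1 (vmark_dist v (phi v)) <= iso_cost r phi.
Proof.
move=> rv; apply: sup_upper_bound; first exact: has_sup_iso_cost.
by left; right; exists v.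
Qed.

Lemma iso_cost_edge r G H (phi : vertex G -> vertex H) v u :
  ball_edges G r (v, u) ->
  Num.min 1 (emark_dist (cap G v u) (cap H (phi v) (phi u))) <= iso_cost r phi.
Proof.
move=> re; apply: sup_upper_bound; first exact: has_sup_iso_cost.
by right; exists (v, u).
Qed.

Lemma iso_cost_ge0 r G H (phi : vertex G -> vertex H) : 0 <= iso_cost r phi.
Proof.
by apply: sup_upper_bound; [exact: has_sup_iso_cost|left; left].
Qed.

Lemma iso_cost_le1 r G H (phi : vertex G -> vertex H) : iso_cost r phi <= 1.
Proof. by apply: iso_cost_le => // *; rewrite ge_min lexx. Qed.

Lemma has_inf_ball_dist r G H : (exists phi, ball_iso r (G := G) (H := H) phi) ->
  has_inf [set iso_cost r phi | phi in [set phi | ball_iso r (G := G) (H := H) phi]].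
Proof.
move=> [phi iphi]; split; first by exists (iso_cost r phi), phi.
by exists 0 => _ [psi _ <-]; exact: iso_cost_ge0.
Qed.

Lemma ball_dist_le r G H (phi : vertex G -> vertex H) : ball_iso r phi ->
  ball_dist r G H <= iso_cost r phi.
Proof.
move=> iphi; rewrite /ball_dist; have ex : exists phi, ball_iso r (G := G) (H := H) phi.
  by exists phi.
rewrite asboolT//; apply: inf_lbound; last by exists phi.
by case: (has_inf_ball_dist ex).
Qed.

Lemma ball_distP r G H (e : R) : 0 < e ->
  ball_dist r G H = 1 \/
  exists2 phi, ball_iso r (G := G) (H := H) phi & iso_cost r phi < ball_dist r G H + e.
Proof.
move=> e0; rewrite /ball_dist; case: asboolP => ex; last by left.
right; have [_ [phi iphi <-] lt] := inf_adherent e0 (has_inf_ball_dist ex).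
by exists phi.
Qed.

Lemma ball_dist_itv r G H : 0 <= ball_dist r G H <= 1.
Proof.
rewrite /ball_dist; case: asboolP => ex; last by rewrite ler01 lexx.
apply/andP; split.
  apply: lb_le_inf; first by case: (has_inf_ball_dist ex).
  by move=> _ [phi _ <-]; exact: iso_cost_ge0.
have [phi iphi] := ex; apply: le_trans (iso_cost_le1 r phi).
by have := ball_dist_le iphi; rewrite /ball_dist asboolT.
Qed.

Lemma ball_distxx r G : ball_dist r G G = 0.
Proof.
have /andP[d0 _] := ball_dist_itv r G G.
apply/eqP; rewrite eq_le d0 andbT.
have iid : @ball_iso r G G id by split => //; split=> // v rv; exists v.
apply: le_trans (ball_dist_le iid) _; apply: iso_cost_le => // [v _|v u _].
  by rewrite vmark_distxx ge_min lexx orbT.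
by rewrite /emark_dist subrr normr0 ge_min lexx orbT.
Qed.

Lemma ball_iso_comp r G H K (phi : vertex G -> vertex H) (psi : vertex H -> vertex K) :
  ball_iso r phi -> ball_iso r psi -> ball_iso r (psi \o phi).
Proof.
move=> [bphi rphi ephi] [bpsi rpsi epsi]; split.
- exact: set_bij_comp bphi bpsi.
- by rewrite /= rphi.
- have [fphi _ _] := bphi => v u rv ru.
  by rewrite ephi// epsi//; exact: fphi.
Qed.

Lemma iso_cost_comp r G H K (phi : vertex G -> vertex H) (psi : vertex H -> vertex K) :
  ball_iso r phi -> iso_cost r (psi \o phi) <= iso_cost r phi + iso_cost r psi.
Proof.
move=> [[fphi _ _] _ ephi]; apply: iso_cost_le.
- by rewrite addr_ge0 ?iso_cost_ge0.
- move=> v rv; apply: le_trans (lerD (iso_cost_vertex phi rv)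
    (iso_cost_vertex psi (fphi _ rv))).
  by apply: min1_triangle; rewrite ?vmark_dist_ge0//; exact: vmark_dist_triangle.
- move=> v u re; have re' : ball_edges H r (phi v, phi u).
    by apply/ephi; [exact: ball_edges_l re|exact: ball_edges_r re|].
  apply: le_trans (lerD (iso_cost_edge phi re) (iso_cost_edge psi re')).
  by apply: min1_triangle; rewrite /emark_dist ?normr_ge0//; exact: ler_distD.
Qed.

Lemma ball_dist_triangle r G H K :
  ball_dist r G K <= ball_dist r G H + ball_dist r H K.
Proof.
have /andP[GH0 _] := ball_dist_itv r G H.
have /andP[HK0 _] := ball_dist_itv r H K.
have /andP[_ GK1] := ball_dist_itv r G K.
apply/ler_addgt0Pr => e e0; have e20 : 0 < e / 2 by rewrite divr_gt0.
have [GH|[phi iphi cphi]] := ball_distP r G H e20; first by rewrite GH; lra.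
have [HK|[psi ipsi cpsi]] := ball_distP r H K e20; first by rewrite HK; lra.
have := ball_dist_le (ball_iso_comp iphi ipsi).
have := iso_cost_comp psi iphi; lra.
Qed.

Lemma ball_iso_inv r G H (phi : vertex G -> vertex H) : ball_iso r phi ->
  exists2 psi : vertex H -> vertex G, ball_iso r psi & iso_cost r psi <= iso_cost r phi.
Proof.
move=> [[fphi iphi sphi] rphi ephi].
have ex w : exists v, ball_vertices H r w -> ball_vertices G r v /\ phi v = w.
  have [/sphi[v rv vw]|nw] := pselect (ball_vertices H r w); first by exists v.
  by exists (root G).
have [psi psiP] := choice ex.
have phiK v : ball_vertices G r v -> psi (phi v) = v.
  move=> rv; have [rpsi ppsi] := psiP _ (fphi _ rv).
  by apply: iphi; rewrite ?inE.
have fpsi w : ball_vertices H r w -> ball_vertices G r (psi w) by move=> /psiP[].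
have psiK w : ball_vertices H r w -> phi (psi w) = w by move=> /psiP[].
exists psi; first split.
- split => //.
  + move=> w w'; rewrite !inE => rw rw' ww'.
    by rewrite -(psiK w)// -(psiK w')// ww'.
  + by move=> v rv; exists (phi v); [exact: fphi|exact: phiK].
- by rewrite -rphi phiK//; exact: ball_root.
- move=> w w' rw rw'; split => [re|].
    by apply/ephi; [exact: fpsi|exact: fpsi|rewrite !psiK].
  by move/ephi; rewrite !psiK//; apply; exact: fpsi.
apply: iso_cost_le; first exact: iso_cost_ge0.
- move=> w rw; rewrite -{1}(psiK w)// vmark_dist_sym.
  by apply: iso_cost_vertex; exact: fpsi.
- move=> w w' re; have [rw rw'] := (ball_edges_l re, ball_edges_r re).
  have : ball_edges G r (psi w, psi w').
    by apply/ephi; [exact: fpsi|exact: fpsi|rewrite !psiK].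
  by move=> /(iso_cost_edge phi); rewrite !psiK// /emark_dist distrC.
Qed.

Lemma ball_dist_sym r G H : ball_dist r G H = ball_dist r H G.
Proof.
suff le G' H' : ball_dist r G' H' <= ball_dist r H' G' by apply/eqP; rewrite eq_le !le.
apply/ler_addgt0Pr => e e0; have /andP[_ d1] := ball_dist_itv r G' H'.
have [->|[phi iphi cphi]] := ball_distP r H' G' e0; first lra.
have [psi ipsi cpsi] := ball_iso_inv iphi.
have := ball_dist_le ipsi; lra.
Qed.

Lemma dlocxx G : dloc G G = 0.
Proof. by apply: wsum0 => r; exact: ball_distxx. Qed.

Lemma dloc_sym G H : dloc G H = dloc H G.
Proof. by congr wsum; apply/funext => r; exact: ball_dist_sym. Qed.

Lemma dloc_triangle H G K : dloc G K <= dloc G H + dloc H K.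
Proof.
by apply: wsum_triangle => r; rewrite ?ball_dist_itv//; exact: ball_dist_triangle.
Qed.

Lemma dloc_ge0 G H : 0 <= dloc G H.
Proof.
have := dloc_triangle H G G; rewrite dlocxx dloc_sym -mulr2n.
by rewrite pmulrn_lge0.
Qed.

HB.instance Definition _ := gen_eqMixin (rgraph T reg).
HB.instance Definition _ := gen_choiceMixin (rgraph T reg).

Definition dloc_eq G H : bool := dloc G H == 0.

Let dloc_eq_refl : reflexive dloc_eq.
Proof. by move=> G; rewrite /dloc_eq dlocxx. Qed.

Let dloc_eq_sym : symmetric dloc_eq.
Proof. by move=> G H; rewrite /dloc_eq dloc_sym. Qed.

Let dloc_eq_trans : transitive dloc_eq.
Proof.
move=> H G K /eqP GH /eqP HK; rewrite /dloc_eq eq_le dloc_ge0 andbT.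
by rewrite (le_trans (dloc_triangle H G K))// GH HK addr0.
Qed.

Canonical dloc_equiv := EquivRel dloc_eq dloc_eq_refl dloc_eq_sym dloc_eq_trans.

End local_distance.

(* The space of rooted marked graphs modulo [dloc = 0]. Isomorphic rooted marked
   graphs are at [dloc]-distance 0, so that passing first to isomorphism classes
   would yield the same quotient. *)
Definition Gstar (R : realType) (T : polishType R) (reg : regime R) : Type :=
  {eq_quot (@dloc_eq R T reg)}%qT.

Section Gstar_metric.
Context {R : realType} {T : polishType R} {reg : regime R}.
Local Notation Gstar := (Gstar T reg).
Local Open Scope quotient_scope.

HB.instance Definition _ := Choice.on Gstar.
HB.instance Definition _ := EqQuotient.on Gstar.

Definition class_of (G : rgraph T reg) : Gstar := \pi G.

Definition Gstar_dist (x y : Gstar) : R := dloc (repr x) (repr y).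

Let dist_xx x : Gstar_dist x x = 0. Proof. exact: dlocxx. Qed.

Let dist_eq0 x y : Gstar_dist x y = 0 -> x = y.
Proof.
move=> xy0; rewrite -[x]reprK -[y]reprK.
by apply/eqmodP; rewrite /= /dloc_eq; apply/eqP.
Qed.

Let dist_sym x y : Gstar_dist x y = Gstar_dist y x.
Proof. exact: dloc_sym. Qed.

Let dist_triangle y x z : Gstar_dist x z <= Gstar_dist x y + Gstar_dist y z.
Proof. exact: dloc_triangle. Qed.

HB.instance Definition _ := isMetric.Build R Gstar dist_xx dist_eq0 dist_sym dist_triangle.

Let rgraph0 : rgraph T reg.
Proof.
refine (@RGraph R T reg unit (@MGraph R T reg unit (fun _ _ => False)
  (fun=> point) (fun=> 0) (fun=> point) (fun _ _ => 1) _ _) tt).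
- by move=> v; rewrite (_ : [set _ | _] = set0)// -subset0.
- by [].
Defined.

HB.instance Definition _ := isPointed.Build Gstar (class_of rgraph0).

Lemma Gstar_distE (G H : rgraph T reg) : mdist (class_of G) (class_of H) = dloc G H.
Proof.
have repr0 K : dloc (repr (class_of K)) K = 0.
  by apply/eqP; have /eqmodP := reprK (class_of K).
change (dloc (repr (class_of G)) (repr (class_of H)) = dloc G H).
apply/eqP; rewrite eq_le; apply/andP; split.
- rewrite (le_trans (dloc_triangle G _ _))// repr0 add0r.
  by rewrite (le_trans (dloc_triangle H _ _))// [X in _ + X]dloc_sym repr0 addr0.
- rewrite (le_trans (dloc_triangle (repr (class_of G)) _ _))// dloc_sym repr0 add0r.
  by rewrite (le_trans (dloc_triangle (repr (class_of H)) _ _))// repr0 addr0.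
Qed.

End Gstar_metric.

Arguments ball_vertices {R T reg} G r.
Arguments ball_edges {R T reg} G r.
Arguments forward {R T reg} G.

Section empirical_measure.
Context {d} {X : measurableType d} {R : realType} {n : nat}.
Variable x : 'I_n.+1 -> X.
Local Open Scope ereal_scope.

Definition empirical (A : set X) : \bar R :=
  (n.+1%:R^-1)%:E * \sum_(i < n.+1) \d_(x i) A.

Let empirical0 : empirical set0 = 0.
Proof. by rewrite /empirical big1 ?mule0// => i _; rewrite measure0. Qed.

Let empirical_ge0 A : 0 <= empirical A.
Proof.
by rewrite mule_ge0// ?lee_fin ?invr_ge0// sume_ge0// => i _; exact: measure_ge0.
Qed.

Let empirical_sigma_additive : semi_sigma_additive empirical.
Proof.
pose m (k : nat) : {measure set X -> \bar R} := \d_(x (inord k)).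
have r0 : (0 <= n.+1%:R^-1 :> R)%R by rewrite invr_ge0.
pose e : {measure set X -> \bar R} := mscale (NngNum r0) (msum m n.+1).
have -> : empirical = e.
  apply/funext => A; rewrite /empirical /e /mscale/= /msum/=; congr (_ * _).
  by apply: eq_bigr => i _; rewrite /m inord_val.
exact: measure_semi_sigma_additive.
Qed.

HB.instance Definition _ := isMeasure.Build _ _ _ empirical
  empirical0 empirical_ge0 empirical_sigma_additive.

Let empirical_setT : empirical setT = 1.
Proof.
rewrite /empirical (eq_bigr (fun=> 1)); last by move=> i _; rewrite diracT.
by rewrite sumEFin sumr_const card_ord -EFinM mulVf// pnatr_eq0.
Qed.

HB.instance Definition _ := Measure_isProbability.Build _ _ _ empirical empirical_setT.

Definition empirical_law : probability X R := empirical.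

End empirical_measure.

Section convergence.
Context {R : realType} {dO : nat -> measure_display}
  {Om : forall n, measurableType (dO n)} (Pr : forall n, probability (Om n) R).

(* Convergence in probability to a constant, the variables being possibly defined on
   different spaces. The outer measure [^*] coincides with [Pr n] on measurable
   sets, and keeps the definition meaningful independently of measurability. *)
Definition cvg_in_prob (Z : forall n, Om n -> R) (c : R) : Prop :=
  forall e, 0 < e ->
    (fun n => ((Pr n)^*)%mu [set w | e <= `|Z n w - c|]) @ \oo --> 0%E.

(* [C] is to be the class of bounded continuous functions. *)
Definition weak_cvg_in_prob {d} {X : measurableType d} (C : set (X -> R))
    (nu_ : forall n, Om n -> probability X R) (nu : probability X R) : Prop :=
  forall h, C h ->
    cvg_in_prob (fun n w => \int[nu_ n w]_x h x) (\int[nu]_x h x).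

End convergence.

Section laws.
Context (R : realType).

Definition Rlaw := probability R R.
HB.instance Definition _ := Choice.on Rlaw.

(* [Rlaw] with the topology of weak convergence. *)
Definition weak_law := initial_topology
  (fun (mu : Rlaw) => (fun h => \int[mu]_x (sval h) x)
    : prod_topology (fun _ : {h : R -> R | bcontinuous R R h} => R)).
HB.instance Definition _ := Topological.on weak_law.

End laws.

(* The law of a random variable; [\d_0] is a junk value for non-measurable functions. *)
Definition law (R : realType) d (Om : measurableType d) (P : probability Om R)
    (Y : Om -> R) : Rlaw R :=
  match pselect (measurable_fun setT Y) with
  | left mY => distribution P (mfun_Sub (mem_set mY))
  | right _ => \d_(0 : R)
  end.

Definition measurable_network (R : realType) (T : polishType R) (reg : regime R)
    d (Om : measurableType d) n (g : Om -> mgraph T reg 'I_n) : Prop :=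
  [/\ forall i j, measurable [set w | edge (g w) i j],
      forall i, measurable_fun setT (fun w => vtype (g w) i : Borel T),
      forall i, measurable_fun setT (fun w => shock (g w) i),
      forall i, measurable_fun setT (fun w => resp (g w) i : Borel (response reg)) &
      forall i j, measurable_fun [set w | edge (g w) i j] (fun w => cap (g w) i j)].

(* The rooted network [G, i, M(G)]. It is transported from ['I_n] to the isomorphic
   type {i : nat | i < n} of a smaller universe: ['I_n] lives in the universe of all
   choice types, and cannot be a [vertex] field of an element of the choice type
   [rgraph]. *)
Section rooted_at.
Context {R : realType} {T : polishType R} {reg : regime R} {n : nat}.
Variable G : mgraph T reg 'I_n.

Let o (v : {i : nat | (i < n)%N}) : 'I_n := Ordinal (svalP v).

Let finite_out_o v : finite_set [set u | edge G (o v) (o u)].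
Proof.
apply: (finite_preimage _ (finite_out G (o v))).
by move=> [u ltu] [w ltw] _ _ /(congr1 val)/= uw; exact: eq_exist.
Qed.

Definition rooted_at (i : 'I_n) : rgraph T reg :=
  @RGraph R T reg {i : nat | (i < n)%N}
    (@MGraph R T reg _ (fun v u => edge G (o v) (o u))
      (fun v => vtype G (o v)) (fun v => shock G (o v)) (fun v => resp G (o v))
      (fun v u => cap G (o v) (o u)) finite_out_o (fun v u => @cap_gt0 _ _ _ _ G (o v) (o u)))
    (exist _ (val i) (ltn_ord i)).

End rooted_at.

Section hypotheses.
Context {R : realType} {T : polishType R} (reg : regime R).
Context {dO : nat -> measure_display} {Om : forall n, measurableType (dO n)}.
Variable Pr : forall n, probability (Om n) R.
(* The networks have vertex set ['I_n.+1]: [net n] is the network with n+1 vertices. *)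
Variable net : forall n, Om n -> mgraph T reg 'I_n.+1.
(* The limiting random rooted network is [X], defined on a probability space [PL];
   its law is the limit law. *)
Context {dL : measure_display} {OL : measurableType dL}.
Variables (PL : probability OL R) (X : {mfun OL >-> Borel (Gstar T reg)}).

Definition limit_network (w : OL) : rgraph T reg := repr (X w : Gstar T reg).

Definition empirical_rooted n (w : Om n) : probability (Borel (Gstar T reg)) R :=
  empirical_law (fun i => class_of (rooted_at (net w) i) : Borel (Gstar T reg)).

Definition local_convergence : Prop :=
  weak_cvg_in_prob (X := Borel (Gstar T reg)) Pr (bcontinuous R (Gstar T reg))
    empirical_rooted (distribution PL X).

(* (A1) and (B2) hold by typing: responses are elements of [response reg]. *)
Definition regime_hypotheses : Prop :=
  match reg with
  | Contractive _ _ =>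
      (ereal_sup (range (fun n =>
         'E_(Pr n)[(fun w => \big[Num.max/0]_i `|shock (net w) i|)%R])) < +oo)%E /\
      local_convergence
  | Nonexpansive =>
      local_convergence /\
      {ae PL, forall w, let G := limit_network w in
        (fun k => upper_iter G k (root G) - lower_iter G k (root G)) @ \oo --> 0}
  end.

(* In the contractive regime the finite equilibrium is unique, and its measurability
   is not an assumption. *)
Definition equilibrium_selection (x : forall n, Om n -> 'I_n.+1 -> R) : Prop :=
  (forall n w, is_equilibrium (net w) (x n w)) /\
  match reg with
  | Contractive _ _ => True
  | Nonexpansive => forall n i, measurable_fun setT (fun w => x n w i)
  end.

(* [xo] is a version of x_o^*. A bounded fixed point of T_G is a function on
   V(G) = [forward G]. *)
Definition limit_equilibrium (xo : {RV PL >-> R}) : Prop :=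
  match reg with
  | Contractive _ _ =>
      {ae PL, forall w, let G := limit_network w in
        exists z : vertex G -> R,
          [/\ exists M, forall v, forward G v -> `|z v| <= M,
              forall v, forward G v -> update G z v = z v &
              z (root G) = xo w]}
  | Nonexpansive =>
      {ae PL, forall w, let G := limit_network w in
        (fun k => lower_iter G k (root G)) @ \oo --> xo w /\
        (fun k => upper_iter G k (root G)) @ \oo --> xo w}
  end.

Definition bounded_marks (Kx : set R) : Prop :=
  match reg with
  | Contractive L _ =>
      exists ebar : T -> R,
        [/\ measurable_fun setT (ebar : Borel T -> R),
            (forall t, 0 <= ebar t) /\ has_ubound (range ebar),
            forall n, {ae Pr n, forall w, forall i,
              `|shock (net w) i| <= ebar (vtype (net w) i)},
            {ae PL, forall w, let G := limit_network w in
              forall v, forward G v -> `|shock G v| <= ebar (vtype G v)} &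
            let K := sup (range ebar) / (1 - L) in Kx = `[- K, K]%classic ]
  | Nonexpansive =>
      exists B : R,
        [/\ forall n, {ae Pr n, forall w, forall i, sup (range (resp (net w) i)) <= B},
            {ae PL, forall w, let G := limit_network w in
              forall v, forward G v -> sup (range (resp G v)) <= B} &
            Kx = `[0, B]%classic ]
  end.

Definition bounded_risk_domain (Kx : set R) (l : T * R -> R) : Prop :=
  [/\ bounded_marks Kx, continuous l &
      exists M, forall t z, Kx z -> `|l (t, z)| <= M].

Definition finite_loss_law (l : T * R -> R) (x : forall n, Om n -> 'I_n.+1 -> R)
    n (w : Om n) : Rlaw R :=
  empirical_law (fun i => l (vtype (net w) i, x n w i)).

Definition limit_loss (l : T * R -> R) (xo : OL -> R) (w : OL) : R :=
  let G := limit_network w in l (vtype G (root G), xo w).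

Definition weak_continuity (D : set (Rlaw R)) (vrho : Rlaw R -> R)
    (eta_ : forall n, Om n -> Rlaw R) (eta : Rlaw R) : Prop :=
  [/\ forall n, {ae Pr n, forall w, D (eta_ n w)},
      D eta,
      (vrho : weak_law R -> R) @ within D (nbhs (eta : weak_law R)) --> vrho eta &
      forall n, measurable_fun setT (fun w => vrho (eta_ n w))].

End hypotheses.

Section risk_functionals.
Context {R : realType} {d : measure_display} {A : measurableType d}.
Variable P : probability A R.

Definition atomless : Prop := forall B, measurable B -> (0 < P B)%E ->
  exists2 C, measurable C /\ C `<=` B & (0 < P C < P B)%E.

Definition Linfty := LfunType P (leey (1 : \bar R)).

Definition same_law (mu nu : Rlaw R) : Prop := forall B, measurable B -> mu B = nu B.

Definition law_invariant (rho : Linfty -> R) : Prop :=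
  forall Y Z : Linfty, same_law (law P Y) (law P Z) -> rho Y = rho Z.

Definition law_representation (rho : Linfty -> R) (D : set (Rlaw R))
    (vrho : Rlaw R -> R) : Prop :=
  forall (Z : Linfty) mu, D mu -> same_law mu (law P Z) -> rho Z = vrho mu.

End risk_functionals.

(* Main.v *)
Require Import Defs.
From mathcomp Require Import finmap.
From mathcomp Require Import all_boot all_order all_algebra.
From mathcomp Require Import all_classical all_reals all_analysis measurable_realfun ess_sup_inf.
Import numFieldNormedType.Exports.
Set Implicit Arguments.
Unset Strict Implicit.
From mathcomp Require Import ring lra.
Import Defs.
Import Order.TTheory GRing.Theory Num.Theory.
Local Open Scope classical_set_scope.
Local Open Scope ring_scope.

(** Both regimes provide, for each depth [k], two functions [lo k] and [hi k] of a rooted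
    network that enclose the equilibrium value at the root: in the nonexpansive regime the
    lower and upper iterates of the update map, which is nondecreasing; in the contractive
    regime the [k]-th iterate from 0, shifted down and up by [L ^+ k * C], where the constant
    [C] bounds every equilibrium because the shocks are uniformly bounded. On the limiting
    network both bounds converge almost surely to the limiting equilibrium value
    ([regime_sandwich]).

    The [k]-th iterates at the root depend only on the marks at depth at most [k], and they
    do so continuously: along isomorphisms of truncations of vanishing cost all these marks
    converge, and the update is a continuous function of the marks and of the values at the
    out-neighbours ([update_cvg]). Hence the bounds, as well as the type of the root, are
    continuous functions on the space of rooted networks
    ([continuous_local_functional]).

    Let [h] be bounded and continuous, and [F := h \o l]. The type of a vertex ranges over a
    space that need not be compact, so [F] need not be uniformly continuous and closeness of
    [lo k] and [hi k] cannot be transferred directly to [F]. Instead, [F (t, _)] is replaced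
    by its supremum [m k] over the segment between the bounds, which is again a bounded
    continuous function of the rooted network ([segment_sup_continuous]). The integral of
    [h] against the empirical loss law is at most that of [m k] against the empirical rooted
    law; by local convergence the latter tends in probability to the integral of [m k]
    against the limit law, and this tends to the limiting loss integral as [k] grows, by
    dominated convergence. This bounds the loss integrals from above
    ([loss_integral_upper]); the same bound for the opposite of [h] bounds them from below.

    The statement on risk functionals follows because convergence of all these integrals in
    probability means that every weak neighbourhood of the limiting loss law contains the
    empirical loss laws with probability tending to 1 ([nbhs_weak_law_vanishing]). *)

(** * Isomorphisms of truncations *)

Section ball_iso.
Context {R : realType} {T : polishType R} {reg : regime R}.
Implicit Types G H : rgraph T reg.

Lemma ball_iso_walk r G H (phi : vertex G -> vertex H) k v : ball_iso r phi ->
  (k <= r)%N -> walk G k (root G) v -> walk H k (root H) (phi v).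
Proof.
move=> iphi; have [[fphi _ _] rphi ephi] := iphi.
elim: k v => [v _ <-//|k IH v kr [w Gw wv]]; exists (phi w).
  by apply: IH => //; exact: ltnW.
have e : ball_edges G r (w, v) by split => //; exists k.
by have [] := (ephi _ _ (ball_edges_l e) (ball_edges_r e)).1 e.
Qed.

Lemma ball_vertices_le r s G : (r <= s)%N -> ball_vertices G r `<=` ball_vertices G s.
Proof. by move=> rs v [k kr Gv]; exists k => //; exact: leq_trans rs. Qed.

Lemma ball_edges_out r s G v u : (r < s)%N -> ball_vertices G r v -> out G v u ->
  ball_edges G s (v, u).
Proof. by move=> rs [k kr Gv] vu; split => //; exists k => //; exact: leq_ltn_trans rs. Qed.

(** The truncation of depth [s] contains every edge leaving a vertex of depth less
    than [s], so that a root-preserving isomorphism of truncations carries the whole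
    out-neighbourhood of such a vertex onto that of its image. This is what lets the
    normalised weights, which involve all outgoing edges, be compared. *)
Lemma ball_iso_out r s G H (phi : vertex G -> vertex H) v : (r < s)%N -> ball_iso s phi ->
  ball_vertices G r v -> set_bij (out G v) (out H (phi v)) phi.
Proof.
move=> rs iphi rv; have [[fphi inphi sphi] rphi ephi] := iphi.
have oe u := @ball_edges_out r s G v u rs rv.
have sv : ball_vertices G s v := ball_vertices_le (ltnW rs) rv.
split.
- move=> u /oe vu.
  by have [] := (ephi _ _ sv (ball_edges_r vu)).1 vu.
- move=> u u'; rewrite !inE => /oe/ball_edges_r vu /oe/ball_edges_r vu'.
  by apply: inphi; rewrite inE.
- move=> w vw.
  have rv' : ball_vertices H r (phi v).
    have [k kr Gv] := rv; exists k => //; apply: ball_iso_walk iphi _ Gv.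
    exact: leq_trans (ltnW rs).
  have e := ball_edges_out rs rv' vw.
  have [u ru uw] := sphi _ (ball_edges_r e).
  by exists u => //; rewrite -uw in e; have [] := (ephi _ _ sv ru).2 e.
Qed.

End ball_iso.

Lemma finite_set_out (R : realType) (T : polishType R) (reg : regime R) V
  (G : mgraph T reg V) v : finite_set (out G v).
Proof. exact: finite_out. Qed.

Lemma fsbig_out_iso (R : realType) (T : polishType R) (reg : regime R) V V'
   (G : mgraph T reg V) (H : mgraph T reg V') (phi : V -> V') v (g : V' -> R) :
  set_bij (out G v) (out H (phi v)) phi ->
  \sum_(u \in out H (phi v)) g u = \sum_(u \in out G v) g (phi u).
Proof. by move=> b; rewrite -(reindex_fsbig (phi : {classic V} -> {classic V'}) _ _ _ b). Qed.

Lemma weightE (R : realType) (T : polishType R) (reg : regime R) V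
   (G : mgraph T reg V) v u : out G v u ->
  weight G v u = cap G v u / \sum_(w \in out G v) cap G v w.
Proof. by move=> vu; rewrite /weight asboolT. Qed.

(** * Convergence of marks and updates along isomorphisms *)

Lemma le_wsum (R : realType) (u : nat -> R) k : (forall k, 0 <= u k <= 1) ->
  2%:R ^- k.+1 * u k <= wsum u.
Proof.
move=> u01; apply: limr_ge; first exact: (is_cvg_wsum u01).
near=> n; have kn : (k < n)%N by near: n; exact: nbhs_infty_gt.
rewrite /series/= big_mkord (bigD1 (Ordinal kn))//= lerDl sumr_ge0// => i _.
by rewrite mulr_ge0 ?invr_ge0 ?exprn_ge0//; case/andP: (u01 i).
Unshelve. all: by end_near. Qed.

Section response_convergence.
Context {R : realType} {reg : regime R} {I : Type} {F : set_system I} {FF : Filter F}.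
Variables (f : I -> response reg) (g : response reg).
Hypothesis fg : mdist g (f i) @[i --> F] --> 0.

Lemma response_lip (r : response reg) x y : `|r x - r y| <= `|x - y|.
Proof.
case: reg r => [L L01|] r; have /= := responseP r; case=> // _ _ _ rL.
apply: le_trans (rL x y) _; have /andP[_ /ltW L1] := L01.
by rewrite ler_piMl.
Qed.

Lemma response_homo (r : response reg) : {homo r : x y / x <= y}.
Proof. by case: reg r => [L L01|] r; have /= := responseP r; case. Qed.

(** In the contractive regime the metric controls the supremum distance on the disk of
    radius [k] through the [k]-th term of the weighted sum; in the nonexpansive regime
    the metric is the supremum distance. *)
Lemma response_cvg_pt z : f i z @[i --> F] --> g z.
Proof.
apply/cvgrPdist_lt => e e0; move: f g fg.
case: reg => [L L01|] f' g' fg'.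
  (* the disk of radius [k + 1] contains [z], and its term has weight [2 ^- k.+1] *)
- set k := Num.truncn `|z|; pose m := Num.min 1 e.
  have m0 : 0 < 2%:R ^- k.+1 * m.
    by rewrite mulr_gt0 ?invr_gt0 ?exprn_gt0// lt_min ltr01.
  have /cvgr0Pnorm_lt/(_ _ m0) := fg'; apply: filterS => i.
  rewrite ger0_norm ?mdist_ge0//= => fgm.
  have bd h : bounded_on (disk k.+1%:R) (h : response (Contractive L01)).
    exact: response_bounded_disk.
  have zk : disk k.+1%:R z by rewrite /disk/= ltW// truncnS_gt.
  have := @sup_dist_ub _ (disk k.+1%:R) g' (f' i) z (bd _) (bd _) zk.
  move=> /le_lt_trans; apply.
  have /(le_wsum k) : forall j, 0 <= Num.min 1 (sup_dist (disk j.+1%:R) g' (f' i)) <= 1.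
    move=> j; apply/min1_itv/sup_dist_ge0; last 2 first.
    + exact: response_bounded_disk.
    + exact: response_bounded_disk.
    by exists 0; rewrite /disk/= normr0.
  move=> /le_lt_trans /(_ fgm); rewrite ltr_pM2l ?invr_gt0 ?exprn_gt0//.
  by rewrite /m /Num.min; do 2 case: ifP; lra.
- have /cvgr0Pnorm_lt/(_ _ e0) := fg'; apply: filterS => i.
  rewrite ger0_norm ?mdist_ge0//= => fgm.
  by apply: le_lt_trans fgm; apply: sup_dist_ub => //; exact: response_bounded.
Qed.

(** All responses share the Lipschitz constant 1, whence joint continuity of the
    evaluation of a response at a point. *)
Lemma response_cvg (y : I -> R) z : y i @[i --> F] --> z ->
  f i (y i) @[i --> F] --> g z.
Proof.
move=> yz; apply/cvgrPdist_lt => e e0; have e2 : 0 < e / 2 by rewrite divr_gt0.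
have /cvgrPdist_lt/(_ _ e2) := yz; have /cvgrPdist_lt/(_ _ e2) := @response_cvg_pt z.
apply: filterS2 => i; have := response_lip (f i) z (y i).
have := ler_distD (f i z) (g z) (f i (y i)); lra.
Qed.

End response_convergence.

Lemma response_sup_cvg (R : realType) (I : Type) (F : set_system I) (FF : Filter F)
  (f : I -> response (@Nonexpansive R)) (g : response (@Nonexpansive R)) :
  mdist g (f i) @[i --> F] --> 0 -> sup (range (f i)) @[i --> F] --> sup (range g).
Proof.
move=> fg; apply/cvgrPdist_le => e e0.
have /cvgr0Pnorm_lt/(_ _ e0) := fg; apply: filterS => i.
rewrite ger0_norm ?mdist_ge0//= => /ltW fgm.
have hs (h : response (@Nonexpansive R)) : has_sup (range h).
  by split; [exists (h 0), 0|have [[B hB] _ _ _] := responseP h; exists B => _ [z _ <-]].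
have d z : `|g z - f i z| <= e.
  apply: le_trans fgm; apply: (@sup_dist_ub _ setT g (f i) z) => //; exact: response_bounded.
have ub (h h' : response (@Nonexpansive R)) : (forall z, h z <= h' z + e) ->
    sup (range h) <= sup (range h') + e.
  move=> hh'; apply: sup_le_ub; first by exists (h 0), 0.
  move=> _ [z _ <-]; apply: le_trans (hh' z) _; rewrite lerD2r.
  by apply: sup_upper_bound => //; exists z.
have := ub g (f i); have := ub (f i) g.
rewrite ler_norml; move=> u1 u2; apply/andP; split.
- have /u1 : forall z, f i z <= g z + e by move=> z; have := d z; rewrite ler_norml; lra.
  lra.
- have /u2 : forall z, g z <= f i z + e by move=> z; have := d z; rewrite ler_norml; lra.
  lra.
Qed.

Lemma cvg_fsbig_sum (R : realType) (J : choiceType) (I : Type) (F : set_system I) (FF : Filter F)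
   (A : set J) (f : J -> I -> R) (l : J -> R) : finite_set A ->
  (forall j, A j -> f j i @[i --> F] --> l j) ->
  (\sum_(j \in A) f j i) @[i --> F] --> \sum_(j \in A) l j.
Proof.
move=> fA fl; have sumE (g : J -> R) :
    \sum_(j \in A) g j = \sum_(j <- fset_set A | j \in fset_set A) g j.
  by rewrite fsbig_finite//= big_seq.
rewrite sumE; under eq_cvg do rewrite sumE.
apply: cvg_big => [|j]; last by rewrite in_fset_set// inE; exact: fl.
by move=> x; exact: add_continuous.
Qed.

Section iso_convergence.
Context {R : realType} {T : polishType R} {reg : regime R} (G : rgraph T reg).
Context {I : Type} {F : set_system I} {FF : Filter F}.
Variables (H : I -> rgraph T reg) (phi : forall i, vertex G -> vertex (H i)).

(** Convergence of rooted networks to [G], witnessed at depth [r] by the isomorphisms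
    [phi i]: fixing the isomorphisms turns closeness of the unlabelled networks into
    convergence of the marks at each vertex and edge of [G], along a filter. *)
Definition iso_cvg r := (\forall i \near F, ball_iso r (phi i)) /\
  iso_cost r (phi i) @[i --> F] --> 0.

Let min1_cvg (a : I -> R) (c : I -> R) : (\forall i \near F, 0 <= a i /\ Num.min 1 (a i) <= c i) ->
  c i @[i --> F] --> 0 -> a i @[i --> F] --> 0.
Proof.
move=> ac c0; apply/cvgr0Pnorm_lt => e e0.
have m0 : 0 < Num.min 1 e by rewrite lt_min ltr01.
have /cvgr0Pnorm_lt/(_ _ m0) := c0; apply: filterS2 ac => i [ai0 ac].
move=> /(le_lt_trans (ler_norm _)) /(le_lt_trans ac).
by rewrite ger0_norm// !lt_min /Num.min; case: ifP; lra.
Qed.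

Lemma vmark_cvg r v : iso_cvg r -> ball_vertices G r v ->
  vmark_dist v (phi i v) @[i --> F] --> 0.
Proof.
move=> [_ cost] rv; apply: min1_cvg cost; apply: nearW => i.
by split; [exact: vmark_dist_ge0|exact: iso_cost_vertex].
Qed.

Lemma vtype_cvg r v : iso_cvg r -> ball_vertices G r v ->
  vtype (H i) (phi i v) @[i --> F] --> vtype G v.
Proof.
move=> iH /(vmark_cvg iH) vc; apply/metricType_numDomainType.cvgrPdist_lt => e e0.
have /cvgr0Pnorm_lt/(_ _ e0) := vc; apply: filterS => i; rewrite ger0_norm ?vmark_dist_ge0//.
by rewrite /vmark_dist gt_max => /andP[].
Qed.

Lemma shock_cvg r v : iso_cvg r -> ball_vertices G r v ->
  shock (H i) (phi i v) @[i --> F] --> shock G v.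
Proof.
move=> iH /(vmark_cvg iH) vc; apply/cvgrPdist_lt => e e0.
have /cvgr0Pnorm_lt/(_ _ e0) := vc; apply: filterS => i; rewrite ger0_norm ?vmark_dist_ge0//.
by rewrite /vmark_dist !gt_max => /and3P[].
Qed.

Lemma resp_cvg r v : iso_cvg r -> ball_vertices G r v ->
  mdist (resp G v) (resp (H i) (phi i v)) @[i --> F] --> 0.
Proof.
move=> iH /(vmark_cvg iH) vc; apply/cvgr0Pnorm_lt => e e0.
have /cvgr0Pnorm_lt/(_ _ e0) := vc; apply: filterS => i; rewrite ger0_norm ?vmark_dist_ge0//.
by rewrite /vmark_dist !gt_max => /and3P[_ _]; rewrite ger0_norm ?mdist_ge0.
Qed.

(** The edge metric compares logarithms, and exponentiation is continuous. *)
Lemma cap_cvg r v u : iso_cvg r -> ball_edges G r (v, u) ->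
  cap (H i) (phi i v) (phi i u) @[i --> F] --> cap G v u.
Proof.
move=> [iso cost] rvu.
have lncvg : ln (cap (H i) (phi i v) (phi i u)) @[i --> F] --> ln (cap G v u).
  apply/subr_cvg0/norm_cvg0P.
  apply: min1_cvg cost; apply: nearW => i; split => //.
  by rewrite distrC; exact: iso_cost_edge (phi i) _ _ rvu.
have Gvu : 0 < cap G v u by apply: cap_gt0; case: rvu.
rewrite -(@lnK _ (cap G v u)) ?posrE//.
apply: cvg_trans; last exact: (continuous_cvg _ (@continuous_expR R _) lncvg).
apply: near_eq_cvg; apply: filterS iso => i [_ _ ephi] /=.
rewrite lnK// posrE; apply: cap_gt0.
by have [] := (ephi _ _ (ball_edges_l rvu) (ball_edges_r rvu)).1 rvu.
Qed.

(** One update consumes one level of depth: its value at [v] is a continuous function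
    of the marks at [v], of the finitely many outgoing capacities, whose sum is positive
    as soon as one edge leaves [v], and of the values at the out-neighbours. *)
Lemma update_cvg r s (zH : forall i, vertex (H i) -> R) (zG : vertex G -> R) :
  (r < s)%N -> iso_cvg s ->
  (forall v, ball_vertices G r.+1 v -> zH i (phi i v) @[i --> F] --> zG v) ->
  forall v, ball_vertices G r v ->
    update (H i) (zH i) (phi i v) @[i --> F] --> update G zG v.
Proof.
move=> rs iH zc v rv.
have rv1 : ball_vertices G s v := ball_vertices_le (ltnW rs) rv.
have oc u : out G v u -> cap (H i) (phi i v) (phi i u) @[i --> F] --> cap G v u.
  by move=> /(ball_edges_out rs rv); exact: cap_cvg.
apply: response_cvg; first exact: resp_cvg rv1.
apply: cvgD; last exact: shock_cvg rv1.
pose S i := \sum_(u \in out G v) (cap (H i) (phi i v) (phi i u) /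
  (\sum_(w \in out G v) cap (H i) (phi i v) (phi i w)) * zH i (phi i u)).
apply: (@cvg_trans _ (S @ F)).
  apply: near_eq_cvg; have [iso _] := iH; apply: filterS iso => i iphi.
  have b := ball_iso_out rs iphi rv; have [fb _ _] := b.
  rewrite (fsbig_out_iso _ b) /S; apply: eq_fsbigr => u; rewrite inE => vu.
  by rewrite weightE ?(fsbig_out_iso _ b)//; exact: fb.
apply: cvg_fsbig_sum => [|u vu]; first exact: finite_set_out.
rewrite weightE//; apply: cvgM; last exact/zc/ball_edges_r/(ball_edges_out (ltnSn r) rv).
apply: cvgM; first exact: oc.
apply: cvgV; last by apply: cvg_fsbig_sum => //; exact: finite_set_out.
rewrite gt_eqF// fsbig_finite//=; last exact: finite_set_out.
have uo : u \in fset_set (out G v) by rewrite in_fset_set ?inE//; exact: finite_set_out.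
rewrite (big_fsetD1 u)//= ltr_wpDr ?cap_gt0// big_seq sumr_ge0// => w.
rewrite inE => /andP[_]; rewrite in_fset_set ?inE; last exact: finite_set_out.
by move=> vw; exact/ltW/(cap_gt0 vw).
Qed.

Lemma iter_update_cvg r k s (zH : forall i, vertex (H i) -> R) (zG : vertex G -> R) :
  (r + k <= s)%N -> iso_cvg s ->
  (forall v, ball_vertices G (r + k) v -> zH i (phi i v) @[i --> F] --> zG v) ->
  forall v, ball_vertices G r v ->
    iter k (update (H i)) (zH i) (phi i v) @[i --> F] --> iter k (update G) zG v.
Proof.
move=> rks iH; elim: k r rks => [|k IH] r rks zc v rv.
  by apply: zc; rewrite addn0.
have rs : (r < s)%N by apply: leq_trans rks; rewrite addnS ltnS leq_addr.
apply: (@update_cvg r s) => // u; rewrite -addSnnS in rks zc.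
exact: IH.
Qed.

End iso_convergence.

(** * Continuous functions on the space of rooted networks *)

Section local_functionals.
Context {R : realType} {T : polishType R} {reg : regime R}.
Implicit Types G H : rgraph T reg.

Lemma ball_dist_le_dloc r G H : ball_dist r G H <= 2%:R ^+ r.+1 * dloc G H.
Proof.
have := @le_wsum _ (fun r => ball_dist r G H) r (fun k => ball_dist_itv k G H).
by rewrite ler_pdivrMl ?exprn_gt0.
Qed.

(** Since the cost of an isomorphism only approximates the infimum defining
    [ball_dist], the isomorphisms are indexed by a pair: the network, and an integer
    [n] bounding the excess of the cost over [ball_dist] by [1 / (n + 1)]. *)
Lemma dloc_iso_cvg r G (J : Type) (F : set_system J) (FF : Filter F)
    (H : J -> rgraph T reg) : dloc G (H j) @[j --> F] --> 0 ->
  exists phi : forall p : J * nat, vertex G -> vertex (H p.1),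
    iso_cvg (F := filter_prod F \oo) phi r.
Proof.
move=> GH.
have ex (p : J * nat) : exists phi : vertex G -> vertex (H p.1),
    ball_dist r G (H p.1) < 1 -> ball_iso r phi /\
      iso_cost r phi < ball_dist r G (H p.1) + p.2.+1%:R^-1.
  have n0 : 0 < p.2.+1%:R^-1 :> R by rewrite invr_gt0.
  have [d1|[phi iphi cphi]] := ball_distP r G (H p.1) n0; last by exists phi.
  by exists (fun=> root (H p.1)); rewrite d1 ltxx.
pose phi p := projT1 (cid (ex p)); exists phi.
have bd : (fun p : J * nat => ball_dist r G (H p.1)) @ filter_prod F \oo --> 0.
  apply: (@cvg_comp _ _ _ fst (fun j => ball_dist r G (H j)) _ F); first exact: cvg_fst.
  apply: (@squeeze_cvgr _ _ _ _ (cst 0) (fun j => 2%:R ^+ r.+1 * dloc G (H j))).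
  - apply: nearW => j; rewrite ball_dist_le_dloc andbT.
    by have /andP[] := ball_dist_itv r G (H j).
  - exact: cvg_cst.
  - by rewrite -[X in _ --> X](mulr0 (2%:R ^+ r.+1)); apply: cvgMr.
have lt1 : \forall p \near filter_prod F \oo, ball_dist r G (H p.1) < 1.
  exact: (cvgr_lt _ bd).
have phiP p : ball_dist r G (H p.1) < 1 -> ball_iso r (phi p) /\
      iso_cost r (phi p) < ball_dist r G (H p.1) + p.2.+1%:R^-1 := projT2 (cid (ex p)).
split; first by apply: filterS lt1 => p /phiP[].
apply: (@squeeze_cvgr _ _ _ _ (cst 0) (fun p => ball_dist r G (H p.1) + p.2.+1%:R^-1)).
- apply: filterS lt1 => p /phiP[_ /ltW ->]; rewrite andbT; exact: iso_cost_ge0.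
- exact: cvg_cst.
- rewrite -[X in _ --> X](addr0 0); apply: cvgD => //.
  apply: (@cvg_comp _ _ _ snd (fun n => n.+1%:R^-1) _ \oo); first exact: cvg_snd.
  exact: cvg_harmonic.
Qed.

(** A function of a rooted network that depends continuously on the marks of a
    truncation of some fixed depth. Being stated through [iso_cvg], the property can be
    checked with limits taken vertex by vertex, and it makes the function continuous on
    the space of networks. *)
Definition local_functional (U : topologicalType) (f : rgraph T reg -> U) :=
  exists r, forall G (J : Type) (F : set_system J) (H : J -> rgraph T reg)
    (phi : forall j, vertex G -> vertex (H j)), Filter F ->
    iso_cvg (F := F) phi r -> f (H j) @[j --> F] --> f G.

Lemma local_functional_cvg (U : topologicalType) (f : rgraph T reg -> U) G
    (J : Type) (F : set_system J) (FF : Filter F) (H : J -> rgraph T reg) :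
  local_functional f -> dloc G (H j) @[j --> F] --> 0 -> f (H j) @[j --> F] --> f G.
Proof.
move=> [r fr] /(dloc_iso_cvg r) [phi iphi] A /(fr _ _ _ _ _ _ iphi)[[P Q]/= [FP FQ] PQ].
have [n Qn] : exists n, Q n by exact: filter_ex FQ.
by apply: (@filterS _ F) FP => j Pj; exact: (PQ (j, n) (conj Pj Qn)).
Qed.

Lemma continuous_local_functional (U : topologicalType) (f : rgraph T reg -> U) :
  local_functional f -> continuous (f \o repr : Gstar T reg -> U).
Proof.
move=> lf x.
apply: (@local_functional_cvg U f (repr x) _ (nbhs x) _ (fun y : Gstar T reg => repr y) lf).
apply/cvgr0Pnorm_lt => e e0.
near=> y; rewrite ger0_norm ?dloc_ge0//.
suff : ball x e y by rewrite ballEmdist.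
by near: y; exact: nbhsx_ballx.
Unshelve. all: by end_near. Qed.

(** A network and the representative of its class are at distance 0, so that the
    constant family equal to one of them converges to the other. *)
Lemma local_functional_repr (U : topologicalType) (f : rgraph T reg -> U) G :
  hausdorff_space U -> local_functional f -> f (repr (class_of G)) = f G.
Proof.
move=> hU lf; have d0 : dloc G (repr (class_of G)) = 0.
  rewrite -Gstar_distE; have -> : class_of (repr (class_of G)) = class_of G.
    by rewrite /class_of reprK.
  by rewrite mdistxx.
have := @local_functional_cvg U f G nat \oo _ (fun=> repr (class_of G)) lf.
rewrite d0 => /(_ _ (cvg_cst _)) fG; apply: (cvg_unique hU _ fG); exact: cvg_cst.
Qed.

Lemma local_functional_type : local_functional (fun G => vtype G (root G)).
Proof.
exists 0%N => G J F H phi FF iH; have rG := ball_root G 0.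
apply: cvg_trans (vtype_cvg iH rG); apply: near_eq_cvg.
by have [iso _] := iH; apply: filterS iso => j [_ -> _].
Qed.

Lemma local_functional_iter k (z : forall G, vertex G -> R) :
  (forall r G (J : Type) (F : set_system J) (H : J -> rgraph T reg)
    (phi : forall j, vertex G -> vertex (H j)), Filter F ->
    iso_cvg (F := F) phi r ->
    forall v, ball_vertices G r v -> z (H j) (phi j v) @[j --> F] --> z G v) ->
  local_functional (fun G => iter k (update G) (z G) (root G)).
Proof.
move=> zc; exists k => G J F H phi FF iH.
have := @iter_update_cvg _ _ _ G J F _ H phi 0 k k (fun j => z (H j)) (z G) (leqnn _) iH.
move=> /(_ _ (zc _ _ _ _ _ _ _ iH) _ (ball_root G 0)).
apply: cvg_trans; apply: near_eq_cvg.
by have [iso _] := iH; apply: filterS iso => j [_ -> _].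
Qed.

Lemma local_functional_lower k : local_functional (fun G => lower_iter G k (root G)).
Proof.
by apply: (@local_functional_iter k (fun=> cst 0)) => *; exact: cvg_cst.
Qed.

End local_functionals.

Lemma local_functional_upper (R : realType) (T : polishType R) k :
  local_functional (fun G : rgraph T (@Nonexpansive R) => upper_iter G k (root G)).
Proof.
apply: (@local_functional_iter _ _ _ k (fun G v => sup (range (resp G v)))).
move=> r G J F H phi FF iH v rv; apply: response_sup_cvg; exact: resp_cvg rv.
Qed.

(** * Iterates and fixed points of the update *)

Lemma ler_fsum (R : realType) (I : choiceType) (A : set I) (f g : I -> R) :
  finite_set A -> (forall i, A i -> f i <= g i) ->
  \sum_(i \in A) f i <= \sum_(i \in A) g i.
Proof.
move=> fA fg; rewrite !fsbig_finite//= big_seq [leRHS]big_seq ler_sum// => i.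
by rewrite in_fset_set// inE; exact: fg.
Qed.

Section network_input.
Context {R : realType} {T : polishType R} {reg : regime R} {V : Type}.
Variable G : mgraph T reg V.
Implicit Types (z y : V -> R) (v u : V).

Let fin v := finite_set_out G v.

Lemma sum_cap_ge0 v : 0 <= \sum_(w \in out G v) cap G v w.
Proof. by apply: fsumr_ge0 => w vw; exact/ltW/(cap_gt0 vw). Qed.

Lemma weight_ge0 v u : 0 <= weight G v u.
Proof.
rewrite /weight; case: asboolP => // vu.
by rewrite divr_ge0 ?sum_cap_ge0// ltW// cap_gt0.
Qed.

(** The sum is 1 if an edge leaves [v], and 0 otherwise. *)
Lemma sum_weight_le1 v : \sum_(u \in out G v) weight G v u <= 1.
Proof.
have -> : \sum_(u \in out G v) weight G v u =
    \sum_(u \in out G v) (cap G v u / \sum_(w \in out G v) cap G v w).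
  by apply: eq_fsbigr => u; rewrite inE; exact: weightE.
set S := \sum_(w \in out G v) cap G v w.
rewrite fsbig_finite//= -mulr_suml -fsbig_finite//= -/S.
by have [->|S0] := eqVneq S 0; rewrite ?mul0r ?mulfV.
Qed.

Definition input z v := \sum_(u \in out G v) weight G v u * z u.

Lemma input_le z y v : (forall u, out G v u -> z u <= y u) -> input z v <= input y v.
Proof.
move=> zy; apply: ler_fsum => [|u /zy uy]; first exact: fin.
exact: ler_wpM2l (weight_ge0 _ _) _ _ uy.
Qed.

Lemma input_dist z y v c : 0 <= c -> (forall u, out G v u -> `|z u - y u| <= c) ->
  `|input z v - input y v| <= c.
Proof.
move=> c0 zy; rewrite /input !fsbig_finite//= -sumrB.
apply: le_trans (ler_norm_sum _ _ _) _.
apply: (@le_trans _ _ (\sum_(u \in out G v) (weight G v u * c))).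
  rewrite -fsbig_finite//=; apply: ler_fsum => // u vu.
  by rewrite -mulrBr normrM (ger0_norm (weight_ge0 _ _)) ler_wpM2l ?weight_ge0 ?zy.
rewrite fsbig_finite//= -mulr_suml -fsbig_finite//= ler_piMl//.
exact: sum_weight_le1.
Qed.

Lemma update_le z y v : (forall u, out G v u -> z u <= y u) ->
  update G z v <= update G y v.
Proof. by move=> /input_le zy; apply: response_homo; rewrite lerD2r. Qed.

End network_input.

Lemma input_rooted_at (R : realType) (T : polishType R) (reg : regime R) n
    (G : mgraph T reg 'I_n) (i : 'I_n) (z : 'I_n -> R) (v : vertex (rooted_at G i)) :
  input (rooted_at G i) (fun u => z (Ordinal (svalP u))) v =
  \sum_j weight G (Ordinal (svalP v)) j * z j.
Proof.
pose o (u : vertex (rooted_at G i)) : 'I_n := Ordinal (svalP u).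
have b : set_bij (out (rooted_at G i) v) (out G (o v)) o.
  split => //.
  - by move=> [u ltu] [w ltw] _ _ /(congr1 val)/= uw; exact: eq_exist.
  - move=> j vj; exists (exist _ (val j) (ltn_ord j)); last exact: val_inj.
    by move: vj; congr edge; exact: val_inj.
transitivity (\sum_(j \in out G (o v)) weight G (o v) j * z j).
  rewrite (fsbig_out_iso _ b) /input; apply: eq_fsbigr => u; rewrite inE => vu.
  rewrite weightE// weightE; last by case: b => + _ _; exact.
  by rewrite (fsbig_out_iso _ b).
rewrite (reindex_fsbig (id : 'I_n -> {classic 'I_n}) [set j | edge G (o v) j]); last first.
  by split => // j vj; exists j.
rewrite -big_enum/= [RHS]fsbig_seq ?enum_uniq//=; apply: fsbig_widen => [j _ /=|j [_ /= nvj]].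
  by rewrite mem_enum.
by rewrite /weight asboolF// mul0r.
Qed.

(** The reindexing needed because the rooted network has the initial segment of the
    natural numbers, as a subtype, for vertex set. *)
Lemma equilibrium_rooted_at (R : realType) (T : polishType R) (reg : regime R) n
    (G : mgraph T reg 'I_n) (i : 'I_n) (x : 'I_n -> R) :
  is_equilibrium G x -> let y (u : vertex (rooted_at G i)) := x (Ordinal (svalP u)) in
  y =1 update (rooted_at G i) y.
Proof.
move=> xG y v; rewrite /update -/(input _ y v) input_rooted_at.
exact: (xG (Ordinal (svalP v))).
Qed.

Section contraction.
Context {R : realType} {T : polishType R} {L : R} {L01 : 0 <= L < 1} {V : Type}.
Variable G : mgraph T (Contractive L01) V.

Lemma contractive_lip (f : response (Contractive L01)) a b : `|f a - f b| <= L * `|a - b|.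
Proof. by have [_ _ _ fL] := responseP f. Qed.

Lemma update_dist (z y : V -> R) v c : 0 <= c ->
  (forall u, out G v u -> `|z u - y u| <= c) ->
  `|update G z v - update G y v| <= L * c.
Proof.
move=> c0 zy; apply: le_trans (contractive_lip _ _ _) _.
rewrite ler_wpM2l; [|by case/andP: L01|] => //.
by rewrite opprD addrACA subrr addr0; exact: input_dist.
Qed.

(** Each update contracts distances by [L], and both functions agree up to [M] at the
    start. The bound is relative to a set [S] closed under the edges because a fixed point
    on a limiting network satisfies its equation only on the vertices reachable from the
    root. *)
Lemma fixpoint_dist (S : set V) (z : V -> R) M k : 0 <= M ->
  (forall v u, S v -> edge G v u -> S u) ->
  (forall v, S v -> update G z v = z v) -> (forall v, S v -> `|z v| <= M) ->
  forall v, S v -> `|z v - lower_iter G k v| <= L ^+ k * M.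
Proof.
move=> M0 SS zfix zM; have /andP[L0 _] := L01.
elim: k => [|k IH] v Sv; first by rewrite subr0 mul1r zM.
rewrite -zfix// exprS -mulrA; apply: update_dist; first by rewrite mulr_ge0 ?exprn_ge0.
by move=> u /(SS _ _ Sv) Su; exact: IH.
Qed.

(** At a vertex [v] maximising the modulus of the fixed point, the contraction and
    [f 0 = 0] give [`|z v| <= L (`|z v| + E)]. *)
Lemma fixpoint_bound (z : V -> R) (v : V) E :
  (forall u, `|z u| <= `|z v|) -> update G z v = z v -> `|shock G v| <= E ->
  `|z v| <= E / (1 - L).
Proof.
move=> zmax zfix shE; have /andP[L0 L1] := L01.
have E0 : 0 <= E by exact: le_trans shE.
have [_ _ f0 _] := responseP (resp G v).
have := contractive_lip (resp G v) (input G z v + shock G v) 0.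
rewrite f0 !subr0 -[X in `|X| <= _]/(update G z v) zfix.
have := @input_dist _ _ _ _ G z (fun=> 0) v _ (normr_ge0 (z v)).
have -> : input G (fun=> 0) v = 0 by apply: fsbig1 => u _; rewrite mulr0.
rewrite subr0 => /(_ _)/wrap[] => [u _|zv]; first by rewrite subr0.
have := ler_normD (input G z v) (shock G v).
rewrite ler_pdivlMr ?subr_gt0//.
move: `|_ + _| `|input _ _ _| zv => a b bz ab za.
have : L * a <= L * (`|z v| + E) by rewrite ler_wpM2l//; lra.
have : L * E <= E by rewrite ler_piMl// ltW.
by lra.
Qed.

End contraction.

Section nonexpansive.
Context {R : realType} {T : polishType R} {V : Type}.
Variable G : mgraph T (@Nonexpansive R) V.

(** The update is nondecreasing, and every value of a response lies between 0 and its
    supremum. *)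
Lemma nonexpansive_sandwich (z : V -> R) k v : z =1 update G z ->
  lower_iter G k v <= z v <= upper_iter G k v.
Proof.
move=> zfix; elim: k v => [|k IH] v.
  rewrite zfix /update; have [fB f0 _ _] := responseP (resp G v).
  rewrite f0/=; apply: sup_upper_bound; last by exists (input G z v + shock G v).
  by split; [exists (resp G v 0), 0|have [B fleB] := fB; exists B => _ [a _ <-]].
rewrite zfix; apply/andP; split; apply: update_le => u _; by have /andP[] := IH u.
Qed.

End nonexpansive.

(** * Integrals of bounded functions and vanishing events *)

Lemma continuous_measurable_Borel (R : realType) (X : ptopologicalType) (f : X -> R) :
  continuous f -> measurable_fun setT (f : Borel X -> R).
Proof.
move=> /continuousP cf.
have := @measurability _ _ (Borel X) (measurableTypeR R) setT f _ (RGenOpens.measurableE R).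
apply => _ [_ [a [b ->] <-]]; rewrite setTI; apply: sub_sigma_algebra.
by apply: cf; exact: interval_open.
Qed.

Section bounded_integrals.
Context {R : realType} {d : measure_display} {X : measurableType d}.

Lemma bounded_integrable (P : probability X R) (f : X -> R) :
  measurable_fun setT f -> (exists M : R, forall x, `|f x| <= M) ->
  P.-integrable setT (EFin \o f).
Proof.
move=> mf [M fM]; apply: measurable_bounded_integrable => //.
  by rewrite (le_lt_trans (probability_le1 P _))// ltry.
exists M; split; first exact: num_real.
by move=> y My x _; exact: le_trans (fM x) (ltW My).
Qed.

Lemma ge0_integral_empirical n (x : 'I_n.+1 -> X) (f : X -> \bar R) :
  measurable_fun setT f -> (forall y, 0 <= f y)%E ->
  (\int[empirical_law x]_y f y = (n.+1%:R^-1)%:E * \sum_(i < n.+1) f (x i))%E.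
Proof.
move=> mf f0; pose m (k : nat) : {measure set X -> \bar R} := \d_(x (inord k)).
have r0 : 0 <= n.+1%:R^-1 :> R by rewrite invr_ge0.
transitivity (\int[mscale (NngNum r0) (msum m n.+1)]_y f y)%E.
  apply: eq_measure_integral => A mA _; rewrite /= /empirical /mscale/= /msum/=.
  by congr (_ * _)%E; apply: eq_bigr => i _; rewrite /m inord_val.
rewrite ge0_integral_mscale// ge0_integral_measure_sum//=; congr (_ * _)%E.
by apply: eq_bigr => i _; rewrite integral_dirac// diracT mul1e /m inord_val.
Qed.

Lemma Rintegral_empirical n (x : 'I_n.+1 -> X) (f : X -> R) :
  measurable_fun setT f -> (exists M : R, forall x, `|f x| <= M) ->
  \int[empirical_law x]_y f y = n.+1%:R^-1 * \sum_(i < n.+1) f (x i).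
Proof.
move=> mf bf; have [M fM] := bf.
have fM0 y : 0 <= f y + M by have := fM y; rewrite ler_norml => /andP[]; lra.
have : \int[empirical_law x]_y (f y + M) = n.+1%:R^-1 * \sum_(i < n.+1) (f (x i) + M).
  rewrite /Rintegral ge0_integral_empirical//.
    by rewrite sumEFin -EFinM.
  by apply/measurable_EFinP; exact: measurable_funD.
rewrite RintegralD//; last 2 first.
  - exact: bounded_integrable.
  - exact: finite_measure_integrable_cst.
rewrite Rintegral_cst//.
have -> : fine (empirical_law (R := R) x setT) = 1.
  by have pT := probability_setT (empirical_law (R := R) x); rewrite -[RHS]/(fine 1%E) -pT.
rewrite mulr1.
rewrite big_split/= sumr_const card_ord mulrDr -[X in _ + _ * X]mulr_natl mulrA.
by rewrite mulVf ?pnatr_eq0// mul1r => /addIr.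
Qed.

Lemma bounded_cvg_Rintegral (P : probability X R) (f_ : nat -> X -> R) (f : X -> R) M :
  (forall k, measurable_fun setT (f_ k)) -> measurable_fun setT f ->
  (forall k x, `|f_ k x| <= M) ->
  {ae P, forall x, f_ k x @[k --> \oo] --> f x} ->
  \int[P]_x f_ k x @[k --> \oo] --> \int[P]_x f x.
Proof.
move=> mf_ mf fM ff.
have [] := @dominated_convergence _ X R P setT measurableT (fun k => EFin \o f_ k)
  (EFin \o f) (cst M%:E).
- by move=> k; exact/measurable_EFinP.
- exact/measurable_EFinP.
- apply: filterS ff => x fx _; by apply/fine_cvgP; split; [exact: nearW|exact: fx].
- exact: finite_measure_integrable_cst.
- by apply: aeW => x k _; rewrite /= lee_fin.
move=> intf _ cv; rewrite /Rintegral; apply: fine_cvg.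
by rewrite fineK//; exact: integrable_fin_num.
Qed.

End bounded_integrals.

Lemma Rintegral_distribution (R : realType) d (X : measurableType d) d'
    (O : measurableType d') (P : probability O R) (Z : {mfun O >-> X}) (f : X -> R) :
  measurable_fun setT f -> (exists M : R, forall x, `|f x| <= M) ->
  \int[distribution P Z]_y f y = \int[P]_w f (Z w).
Proof.
move=> mf [M fM]; rewrite /Rintegral integral_distribution//.
  exact/measurable_EFinP.
apply: (@bounded_integrable _ _ _ P (f \o Z)); last by exists M => w; exact: fM.
exact: measurableT_comp.
Qed.

Section outer_vanishing.
Context {R : realType} {dO : nat -> measure_display}
  {Om : forall n, measurableType (dO n)} (Pr : forall n, probability (Om n) R).

(** The form in which convergence in probability is handled: outer measures are
    monotone and subadditive on all sets, whence stability under subsets and unions. *)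
Definition vanishing (E : forall n, set (Om n)) :=
  (fun n => ((Pr n)^*)%mu (E n)) @ \oo --> 0%E.

Lemma vanishing_sub (E F : forall n, set (Om n)) : (forall n, E n `<=` F n) ->
  vanishing F -> vanishing E.
Proof.
move=> EF F0; apply: (@squeeze_cvge _ _ _ _ (cst 0%E) _ (fun n => ((Pr n)^*)%mu (F n))) => //.
- apply: nearW => n /=; apply/andP; split; first exact: mu_ext_ge0 (measure_ge0 _) _.
  by apply: le_mu_ext; exact: EF.
- exact: cvg_cst.
Qed.

Lemma vanishingU (E F : forall n, set (Om n)) : vanishing E -> vanishing F ->
  vanishing (fun n => E n `|` F n).
Proof.
move=> E0 F0.
apply: (@squeeze_cvge _ _ _ _ (cst 0%E) _
  (fun n => ((Pr n)^*)%mu (E n) + ((Pr n)^*)%mu (F n))%E) => //.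
- apply: nearW => n /=; apply/andP; split; first exact: mu_ext_ge0 (measure_ge0 _) _.
  exact: outer_measureU2.
- exact: cvg_cst.
- by rewrite -[X in _ --> X](adde0 0%E); apply: cvgeD.
Qed.

Lemma vanishing_ae (E : forall n, set (Om n)) :
  (forall n, {ae Pr n, forall w, ~ E n w}) -> vanishing E.
Proof.
move=> E0; rewrite /vanishing; suff -> : (fun n => ((Pr n)^*)%mu (E n)) = cst 0%E by exact: cvg_cst.
apply/funext => n; have [N [mN N0 EN]] := E0 n.
apply/eqP; rewrite eq_le (mu_ext_ge0 (measure_ge0 _)) andbT -N0 -(measurable_mu_extE _ mN).
by apply: le_mu_ext => w Ew; apply: EN => /(_ Ew).
Qed.

End outer_vanishing.

(** * Suprema over segments and joint measurability *)

(** By compactness the continuity of [g] in the parameter is uniform over [K]. *)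
Lemma continuous_sup_compact (R : realType) (P U : topologicalType) (K : set U)
    (g : P * U -> R) (M : R) : compact K -> K !=set0 -> continuous g ->
  (forall x, `|g x| <= M) -> continuous (fun p => sup [set g (p, u) | u in K]).
Proof.
move=> /compact_near_coveringP cK [u0 Ku0] cg gM p.
apply/cvgrPdist_le => e e0.
have hs q : has_sup [set g (q, u) | u in K].
  split; first by exists (g (q, u0)), u0.
  by exists M => _ [u _ <-]; exact: le_trans (ler_norm _) (gM _).
have ub q q' : (forall u, K u -> g (q, u) <= g (q', u) + e) ->
    sup [set g (q, u) | u in K] <= sup [set g (q', u) | u in K] + e.
  move=> qq'; apply: sup_le_ub; first by exists (g (q, u0)), u0.
  move=> _ [u Ku <-]; apply: le_trans (qq' _ Ku) _; rewrite lerD2r.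
  by apply: sup_upper_bound => //; exists u.
have /(cK _ _ (fun p' u' => `|g (p, u') - g (p', u')| <= e) _) : forall u, K u ->
    \forall u' \near u & p' \near p, `|g (p, u') - g (p', u')| <= e.
  move=> u Ku; have e2 : 0 < e / 2 by rewrite divr_gt0.
  have /cvgrPdist_lt/(_ _ e2)[[A B]/= [pA uB] AB] := cg (p, u).
  exists (B, A) => // -[u' p']/= [Bu' Ap'].
  have := AB (p, u') (conj (nbhs_singleton pA) Bu'); have := AB (p', u') (conj Ap' Bu').
  move=> /= /ltW h1 /ltW h2; have := ler_distD (g (p, u)) (g (p, u')) (g (p', u')).
  rewrite (distrC (g (p, u')) (g (p, u))); lra.
apply: filterS => p' pp'; rewrite ler_norml; apply/andP; split.
- have : sup [set g (p', u) | u in K] <= sup [set g (p, u) | u in K] + e.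
    by apply: ub => u /pp'; rewrite ler_norml => /andP[]; lra.
  lra.
- have : sup [set g (p, u) | u in K] <= sup [set g (p', u) | u in K] + e.
    by apply: ub => u /pp'; rewrite ler_norml => /andP[]; lra.
  lra.
Qed.

Section envelope.
Context {R : realType} {T : topologicalType}.
Variables (F : T * R -> R) (M : R).
Hypotheses (cF : continuous F) (FM : forall p, `|F p| <= M).

(** The segment from [p.2.1] to [p.2.2] is parametrised by [0, 1] in order that the
    supremum range over a fixed compact set while the endpoints vary. *)
Definition segment_sup (p : T * (R * R)) : R :=
  sup [set F (p.1, p.2.1 + u * (p.2.2 - p.2.1)) | u in `[0, 1]].

Let seg0 : [set` `[0, 1 : R]] !=set0.
Proof. by exists 0; rewrite /= in_itv/= lexx ler01. Qed.

Lemma segment_sup_continuous : continuous segment_sup.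
Proof.
apply: (@continuous_sup_compact _ _ _ _
  (fun q : (T * (R * R)) * R => F (q.1.1, q.1.2.1 + q.2 * (q.1.2.2 - q.1.2.1))) M) => //.
- exact: segment_compact.
- move=> q.
  have c1 : {for q, continuous (fun q : (T * (R * R)) * R => q.1)} by exact: cvg_fst.
  have c2 : {for q, continuous (fun q : (T * (R * R)) * R => q.2)} by exact: cvg_snd.
  have c11 : {for q, continuous (fun q : (T * (R * R)) * R => q.1.1)}.
    by apply: (continuous_cvg _ _ c1); exact: cvg_fst.
  have c12 : {for q, continuous (fun q : (T * (R * R)) * R => q.1.2)}.
    by apply: (continuous_cvg _ _ c1); exact: cvg_snd.
  have c121 : {for q, continuous (fun q : (T * (R * R)) * R => q.1.2.1)}.
    by apply: (continuous_cvg _ _ c12); exact: cvg_fst.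
  have c122 : {for q, continuous (fun q : (T * (R * R)) * R => q.1.2.2)}.
    by apply: (continuous_cvg _ _ c12); exact: cvg_snd.
  apply: (@continuous2_cvg _ _ _ _ _ _ _ _ (fun t r => F (t, r)) _ _ _ c11).
    by under eq_cvg do rewrite -surjective_pairing; exact: cF.
  exact: (cvgD c121 (cvgM c2 (cvgB c122 c121))).
Qed.

Lemma segment_sup_ge t a b z : a <= z <= b -> F (t, z) <= segment_sup (t, (a, b)).
Proof.
move=> /andP[az zb]; apply: sup_upper_bound.
  split; first by have [u Ku] := seg0; exists (F (t, a + u * (b - a))), u.
  by exists M => _ [u _ <-]; exact: le_trans (ler_norm _) (FM _).
have [ab|ab] := eqVneq a b.
  exists 0; rewrite /= ?in_itv/= ?lexx ?ler01//.
  by congr (F (t, _)); lra.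
have ba : 0 < b - a by rewrite subr_gt0 lt_neqAle ab (le_trans az).
exists ((z - a) / (b - a)) => /=; last by rewrite divfK ?gt_eqF// addrC subrK.
by rewrite in_itv/= divr_ge0 ?subr_ge0 ?(le_trans az)//= ler_pdivrMr// mul1r lerD2r.
Qed.

Lemma segment_sup_point t a : segment_sup (t, (a, a)) = F (t, a).
Proof.
rewrite /segment_sup/= (_ : [set _ | _ in _] = [set F (t, a)]) ?sup1//.
apply/seteqP; split => [_ [u _ <-]|_ ->]/=; first by rewrite subrr mulr0 addr0.
by exists 0; rewrite /= ?in_itv/= ?lexx ?ler01// subrr mulr0 addr0.
Qed.

Lemma segment_sup_bounded p : `|segment_sup p| <= M.
Proof.
have [u Ku] := seg0; set v := F (p.1, p.2.1 + u * (p.2.2 - p.2.1)).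
have hs : has_sup [set F (p.1, p.2.1 + u * (p.2.2 - p.2.1)) | u in `[0, 1]].
  split; first by exists v, u.
  by exists M => _ [w _ <-]; exact: le_trans (ler_norm _) (FM _).
rewrite ler_norml; apply/andP; split.
- apply: (@le_trans _ _ v).
    by have := FM (p.1, p.2.1 + u * (p.2.2 - p.2.1)); rewrite ler_norml => /andP[].
  by apply: sup_upper_bound => //; exists u.
- apply: sup_le_ub; first by exists v, u.
  by move=> _ [w _ <-]; exact: le_trans (ler_norm _) (FM _).
Qed.

End envelope.

(** The function [y] is approximated by functions with countably many values, the
    multiples of [1 / (m + 1)], for which the claim is a countable union; continuity in
    the real argument gives the limit. This avoids comparing the Borel sets of a product
    with the product of the Borel sets. *)
Lemma measurable_caratheodory (R : realType) d (O : measurableType d) (T : Type)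
    (F : T * R -> R) (t : O -> T) (y : O -> R) :
  (forall q, measurable_fun setT (fun w => F (t w, q))) ->
  (forall s, continuous (fun z => F (s, z))) ->
  measurable_fun setT y -> measurable_fun setT (fun w => F (t w, y w)).
Proof.
move=> mF cF my.
pose fl (m : nat) (w : O) : int := Num.floor (m.+1%:R * y w).
pose yq (m : nat) (w : O) : R := (fl m w)%:~R / m.+1%:R.
apply: (@measurable_fun_cvg _ _ _ _ (fun m w => F (t w, yq m w))); last first.
  move=> w _; apply: (continuous_cvg _ (cF (t w) (y w))).
  apply/cvgrPdist_lt => e e0; near=> m.
  have m0 : 0 < m.+1%:R :> R by [].
  have := floor_itv (m.+1%:R * y w); rewrite -/(fl m w) intrD => /andP[f1 f2].
  have -> : y w - yq m w = (m.+1%:R * y w - (fl m w)%:~R) / m.+1%:R.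
    by rewrite mulrBl mulrAC mulfV ?mul1r// gt_eqF.
  rewrite ger0_norm ?divr_ge0 ?subr_ge0//.
  apply: (@le_lt_trans _ _ m.+1%:R^-1).
    by rewrite ler_pdivrMr// mulVf ?gt_eqF//; lra.
  near: m; have /cvgr0Pnorm_lt/(_ _ e0) := @cvg_harmonic R.
  by apply: filterS => m; rewrite /= ger0_norm.
move=> m _ B mB; rewrite setTI.
have -> : (fun w => F (t w, yq m w)) @^-1` B =
    \bigcup_(k : int) ([set w | fl m w = k] `&` (fun w => F (t w, k%:~R / m.+1%:R)) @^-1` B).
  apply/seteqP; split => [w Bw|w [k _ [/= <-]]//].
  by exists (fl m w).
apply: countable_bigcupT_measurable => // k; apply: measurableI; last first.
  by rewrite -[X in measurable X]setTI; exact: mF.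
have -> : [set w | fl m w = k] = y @^-1` `[k%:~R / m.+1%:R, (k + 1)%:~R / m.+1%:R[%classic.
  apply/seteqP; split => w /=; rewrite in_itv/= ler_pdivrMr// ltr_pdivlMr// (mulrC (y w)).
    by move=> <-; exact: floor_itv.
  by rewrite -floor_eq => /eqP.
by rewrite -[X in measurable X]setTI; apply: my.
Unshelve. all: by end_near. Qed.

(** * Sandwich of the equilibria and upper bounds on the loss integrals *)

Lemma cvg_to_pair (J : Type) (F : set_system J) (FF : Filter F) (U V : topologicalType)
    (f : J -> U) (g : J -> V) (a : U) (b : V) :
  f j @[j --> F] --> a -> g j @[j --> F] --> b -> (f j, g j) @[j --> F] --> (a, b).
Proof. by move=> fa gb; exact: (@cvg_pair _ _ _ F (nbhs a) (nbhs b)). Qed.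

Lemma local_functional_addr (R : realType) (T : polishType R) (reg : regime R)
    (f : rgraph T reg -> R) c :
  local_functional f -> local_functional (fun G => f G + c).
Proof.
move=> [r fr]; exists r => G J F H phi FF iH.
by apply: cvgD; [exact: (fr _ _ _ _ _ _ iH)|exact: cvg_cst].
Qed.

Lemma root_rooted_at (R : realType) (T : polishType R) (reg : regime R) n
    (G : mgraph T reg 'I_n) (i : 'I_n) :
  Ordinal (svalP (root (rooted_at G i))) = i.
Proof. exact: val_inj. Qed.

(** A finite equilibrium attains its maximal modulus, which is therefore at most
    [E / (1 - L)]; the iterates from 0 then approach it at a geometric rate that depends
    neither on the network nor on its size. *)
Lemma equilibrium_dist (R : realType) (T : polishType R) (L : R) (L01 : 0 <= L < 1) n
    (G : mgraph T (Contractive L01) 'I_n.+1) (x : 'I_n.+1 -> R) (E : R) i k :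
  is_equilibrium G x -> (forall j, `|shock G j| <= E) ->
  `|x i - lower_iter (rooted_at G i) k (root (rooted_at G i))| <= L ^+ k * (E / (1 - L)).
Proof.
move=> xG shE; have /= yfix := equilibrium_rooted_at (i := i) xG.
pose y (u : vertex (rooted_at G i)) := x (Ordinal (svalP u)).
pose i0 := [arg max_(j > ord0) `|x j|]%O.
have xmax j : `|x j| <= `|x i0|.
  by rewrite /i0; case: arg_maxP => //= j0 _; exact.
pose v0 : vertex (rooted_at G i) := exist _ (val i0) (ltn_ord i0).
have yv0 : y v0 = x i0 by rewrite /y; congr x; exact: val_inj.
have yC u : `|y u| <= E / (1 - L).
  apply: (@le_trans _ _ `|y v0|); first by rewrite yv0 xmax.
  apply: (@fixpoint_bound _ _ _ _ _ (rooted_at G i)); last exact: shE.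
    by move=> u'; rewrite yv0 xmax.
  by rewrite -yfix.
have := @fixpoint_dist _ _ _ _ _ (rooted_at G i) setT y (E / (1 - L)) k _ _ _ _
  (root (rooted_at G i)) I.
have -> : y (root (rooted_at G i)) = x i by rewrite /y root_rooted_at.
apply => //; first exact: le_trans (normr_ge0 _) (yC v0).
by move=> v _; rewrite -yfix.
Qed.

Section limit_theorem.
Context {R : realType} {T : polishType R}.
Context {dO : nat -> measure_display} {Om : forall n, measurableType (dO n)}.
Variable Pr : forall n, probability (Om n) R.
Context {dL : measure_display} {OL : measurableType dL} (PL : probability OL R).

(** The common form taken by the two regimes. In the contractive one the bounds are
    the iterates from 0, shifted by the uniform geometric error; in the nonexpansive one
    they are the lower and upper iterates themselves. *)
Lemma regime_sandwich (reg : regime R) (net : forall n, Om n -> mgraph T reg 'I_n.+1)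
    (X : {mfun OL >-> Borel (Gstar T reg)})
    (x : forall n, Om n -> 'I_n.+1 -> R) (xo : {RV PL >-> R}) Kx :
  equilibrium_selection net x -> limit_equilibrium X xo -> bounded_marks Pr net PL X Kx ->
  exists lo hi : nat -> rgraph T reg -> R,
    [/\ forall k, local_functional (lo k),
        forall k, local_functional (hi k),
        forall n, {ae Pr n, forall w, forall i k,
          lo k (rooted_at (net n w) i) <= x n w i <= hi k (rooted_at (net n w) i)} &
        {ae PL, forall w, lo k (limit_network X w) @[k --> \oo] --> xo w /\
          hi k (limit_network X w) @[k --> \oo] --> xo w}].
Proof.
destruct reg as [L L01|].
- move=> [xeq _] xoP [ebar [_ [_ ubE] finE _ _]]; have /andP[L0 L1] := L01.
  pose C := sup (range ebar) / (1 - L).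
  have lo0 (c : R) : L ^+ k * c @[k --> \oo] --> 0.
    rewrite -[X in _ --> X](mul0r c); apply: cvgM; last exact: cvg_cst.
    by apply: cvg_expr; rewrite ger0_norm.
  exists (fun k (G : rgraph T _) => lower_iter G k (root G) + - (L ^+ k * C)).
  exists (fun k (G : rgraph T _) => lower_iter G k (root G) + L ^+ k * C); split.
  + by move=> k; exact/local_functional_addr/local_functional_lower.
  + by move=> k; exact/local_functional_addr/local_functional_lower.
  + move=> n; apply: filterS (finE n) => w shE i k.
    have shE' j : `|shock (net n w) j| <= sup (range ebar).
      apply: le_trans (shE j) _; apply: sup_upper_bound; last by exists (vtype (net n w) j).
      by split=> //; exists (ebar point), point.
    have := equilibrium_dist i k (xeq n w) shE'.
    by rewrite -/C ler_norml; move=> /andP[? ?]; apply/andP; split; lra.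
  + apply: filterS xoP => w [z [[M zM] zfix zroot]].
    set G := limit_network X w.
    have rG : forward G (root G) by exists 0%N.
    have lc : lower_iter G k (root G) @[k --> \oo] --> xo w.
      rewrite -zroot; apply/subr_cvg0/norm_cvg0P.
      apply: (@squeeze_cvgr _ _ _ _ (cst 0) (fun k => L ^+ k * M)) => //; last exact: cvg_cst.
      apply: nearW => k; rewrite normr_ge0 distrC/=.
      apply: (@fixpoint_dist _ _ _ _ _ G (forward G)) => //.
        exact: le_trans (zM _ rG).
      by move=> v u [j Gv] vu; exists j.+1, v.
    split; rewrite -[xo w]addr0; apply: cvgD => //.
    by rewrite -oppr0; apply: cvgN; exact: (lo0 C).
- move=> [xeq _] xoP _.
  exists (fun k (G : rgraph T _) => lower_iter G k (root G)).
  exists (fun k (G : rgraph T _) => upper_iter G k (root G)); split => //.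
  + exact: local_functional_lower.
  + exact: local_functional_upper.
  + move=> n; apply: aeW => w i k.
    have := nonexpansive_sandwich k (root (rooted_at (net n w) i))
      (equilibrium_rooted_at (i := i) (xeq n w)).
    by rewrite root_rooted_at.
Qed.

Variables (reg : regime R) (net : forall n, Om n -> mgraph T reg 'I_n.+1).
Variables (X : {mfun OL >-> Borel (Gstar T reg)}).
Variables (x : forall n, Om n -> 'I_n.+1 -> R) (xo : {RV PL >-> R}) (l : T * R -> R).
Hypothesis cl : continuous l.

Let root_type (y : Gstar T reg) : T := vtype (repr y : rgraph T reg) (root (repr y)).

Let root_type_continuous : continuous root_type.
Proof. exact: continuous_local_functional local_functional_type. Qed.

Lemma measurable_limit_loss : measurable_fun setT (limit_loss X l xo).
Proof.
apply: (measurable_caratheodory (F := l) (t := fun w => root_type (X w))) => [q|t|].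
- have c : continuous (fun y => l (root_type y, q)).
    move=> y.
    apply: (@continuous_cvg _ _ _ _ (nbhs_filter y) (fun y => (root_type y, q)) l _ (@cl _)).
    by apply: cvg_to_pair; [exact: root_type_continuous|exact: cvg_cst].
  exact: measurableT_comp (continuous_measurable_Borel c) (measurable_funPT X).
- move=> z; apply: (@continuous_cvg _ _ _ _ (nbhs_filter z) (fun z => (t, z)) l _ (@cl _)).
  by apply: cvg_to_pair; [exact: cvg_cst|exact: cvg_id].
- exact: measurable_funPT.
Qed.

Section one_sided.
Variables (lo hi : nat -> rgraph T reg -> R).
Hypotheses (loL : forall k, local_functional (lo k)) (hiL : forall k, local_functional (hi k)).
Hypothesis fin_sandwich : forall n, {ae Pr n, forall w, forall i k,
  lo k (rooted_at (net w) i) <= x w i <= hi k (rooted_at (net w) i)}.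
Hypothesis lim_sandwich : {ae PL, forall w, lo k (limit_network X w) @[k --> \oo] --> xo w /\
  hi k (limit_network X w) @[k --> \oo] --> xo w}.
Hypothesis PnP : local_convergence Pr net PL X.

(** The segment between the bounds [lo k] and [hi k] contains the equilibrium, hence the
    loss integral is at most the integral of the continuous local function [m k] against
    the empirical rooted law. The latter integral converges in probability, and its limit
    tends to the loss integral of the limit as [k] grows, by dominated convergence. *)
Lemma loss_integral_upper h e : bcontinuous R R h -> 0 < e ->
  vanishing Pr (fun n => [set w |
    e <= \int[finite_loss_law net l x w]_y h y - \int[PL]_w h (limit_loss X l xo w)]).
Proof.
move=> [ch [M hM]] e0.
pose F := h \o l; have FM p : `|F p| <= M by exact: hM.
have cF : continuous F by move=> p; apply: continuous_comp; [exact: cl|exact: ch].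
pose m k (y : Gstar T reg) := segment_sup F (root_type y, (lo k (repr y), hi k (repr y))).
have mM k y : `|m k y| <= M by exact: segment_sup_bounded.
have cm k : continuous (m k).
  move=> y.
  apply: (@continuous_cvg _ _ _ _ (nbhs_filter y)
    (fun y => (root_type y, (lo k (repr y), hi k (repr y))))
    (segment_sup F) _ (@segment_sup_continuous _ _ _ _ cF FM _)).
  apply: cvg_to_pair; first exact: root_type_continuous.
  by apply: cvg_to_pair; exact: continuous_local_functional.
have mm k := continuous_measurable_Borel (cm k).
have mX k : measurable_fun setT (fun w => m k (X w)).
  exact: measurableT_comp (mm k) (measurable_funPT X).
have mh : measurable_fun setT h by exact: continuous_measurable_fun.
set c := \int[PL]_w h (limit_loss X l xo w).
have mc : \int[PL]_w m k (X w) @[k --> \oo] --> c.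
  apply: (@bounded_cvg_Rintegral _ _ _ _ _ _ M) => //.
    exact: measurableT_comp mh measurable_limit_loss.
  apply: filterS lim_sandwich => w [loc hic].
  rewrite /limit_loss -[X in _ --> X]/(F (root_type (X w), xo w)) -(segment_sup_point F).
  apply: (@continuous_cvg _ _ _ _ eventually_filter
    (fun k => (root_type (X w), (lo k (repr (X w)), hi k (repr (X w)))))
    (segment_sup F) _ (@segment_sup_continuous _ _ _ _ cF FM _)).
  by apply: cvg_to_pair; [exact: cvg_cst|exact: cvg_to_pair].
have e2 : 0 < e / 2 by rewrite divr_gt0.
have /filter_ex[k mk] : \forall k \near \oo, \int[PL]_w m k (X w) < c + e / 2.
  by apply: (cvgr_lt _ mc); rewrite ltrDl.
have key := PnP (conj (cm k) (ex_intro _ M (mM k))) e2.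
apply: (@vanishing_sub _ _ _ Pr _ (fun n => [set w | ~ forall i k,
    lo k (rooted_at (net w) i) <= x w i <= hi k (rooted_at (net w) i)] `|` _)); last first.
  apply: vanishingU key; apply: vanishing_ae => n.
  by apply: filterS (@fin_sandwich n) => w sw /=; exact.
move=> n w /= ew.
have [sw|nsw] := pselect (forall i k,
  lo k (rooted_at (net w) i) <= x w i <= hi k (rooted_at (net w) i)); last by left.
right; rewrite Rintegral_distribution//; last by exists M.
apply: le_trans (ler_norm _); move: mk ew.
suff : \int[finite_loss_law net l x w]_y h y <= \int[empirical_rooted net w]_y m k y.
  rewrite -/c; lra.
rewrite /finite_loss_law /empirical_rooted !Rintegral_empirical//; last 2 first.
  by exists M.
  by exists M.
rewrite ler_wpM2l ?invr_ge0//; apply: ler_sum => i _.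
have T2 : hausdorff_space T by exact: metric_hausdorff.
have R2 : hausdorff_space R by exact: Rhausdorff.
rewrite /m /root_type (local_functional_repr _ R2 (loL k)) (local_functional_repr _ R2 (hiL k)).
rewrite (local_functional_repr _ T2 local_functional_type).
have -> : vtype (rooted_at (net w) i) (root (rooted_at (net w) i)) = vtype (net w) i.
  by rewrite -[in RHS](root_rooted_at (net w) i).
exact: segment_sup_ge.
Qed.

End one_sided.
End limit_theorem.

(** * Weak neighbourhoods, laws and essentially bounded variables *)

(** The sets that [mu_ n] belongs to outside a vanishing event form a filter, which
    converges to [mu] because it does so under each of the integrals generating the weak
    topology. *)
Lemma nbhs_weak_law_vanishing (R : realType) (dO : nat -> measure_display)
    (Om : forall n, measurableType (dO n)) (Pr : forall n, probability (Om n) R)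
    (mu_ : forall n, Om n -> Rlaw R) (mu : Rlaw R) (U : set (Rlaw R)) :
  weak_cvg_in_prob Pr (bcontinuous R R) mu_ mu -> nbhs (mu : weak_law R) U ->
  vanishing Pr (fun n => [set w | ~ U (mu_ n w)]).
Proof.
move=> mumu [B [[A oA <-] Bmu] BU].
pose f (nu : Rlaw R) : {h : R -> R | bcontinuous R R h} -> R :=
  fun h => \int[nu]_x (sval h) x.
pose F : set_system ({h : R -> R | bcontinuous R R h} -> R) :=
  fun V => vanishing Pr (fun n => [set w | ~ V (f (mu_ n w))]).
have FF : Filter F.
  split.
  - by apply: vanishing_ae => n; apply: aeW => w /=; exact.
  - move=> V W FV FW; apply: vanishing_sub (vanishingU FV FW) => n w /=.
    by move=> /not_andP[]; [left|right].
  - by move=> V W VW; apply: vanishing_sub => n w /= nW /VW.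
have Ff : F --> (f mu : prod_topology (fun _ : {h : R -> R | bcontinuous R R h} => R)).
  apply/cvg_sup => h V [C [[D oD <-] Dmu] CV].
  have hF : (fun g : {h : R -> R | bcontinuous R R h} -> R => g h) @ F --> f mu h.
    apply/cvgrPdist_lt => e e0.
    apply: vanishing_sub (mumu (sval h) (svalP h) e e0) => n w /= /negP.
    by rewrite -leNgt distrC.
  apply: filterS CV _; apply: hF; exact: open_nbhs_nbhs.
have FA : F A by apply: Ff; exact: open_nbhs_nbhs.
by apply: vanishing_sub FA => n w /= nU fA; apply: nU; exact: BU.
Qed.

Lemma Rintegral_law (R : realType) d (O : measurableType d) (P : probability O R)
    (Y : O -> R) (h : R -> R) : measurable_fun setT Y -> bcontinuous R R h ->
  \int[law P Y]_y h y = \int[P]_w h (Y w).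
Proof.
move=> mY [ch bh]; rewrite /law; case: pselect => // mY'.
by rewrite Rintegral_distribution//; exact: continuous_measurable_fun.
Qed.

Lemma law_setE (R : realType) d (O : measurableType d) (P : probability O R)
    (Y : O -> R) (B : set R) : measurable_fun setT Y -> law P Y B = P (Y @^-1` B).
Proof. by move=> mY; rewrite /law; case: pselect. Qed.

(** A variable with values in a compact interval almost surely is essentially
    bounded, although it may be unbounded as a function. *)
Lemma ae_bounded_Linfty (R : realType) d (O : measurableType d) (P : probability O R)
    (Y : O -> R) (a b : R) : measurable_fun setT Y ->
  P (Y @^-1` `[a, b]%classic) = 1%E -> exists Z : Linfty P, Z =1 Y.
Proof.
move=> mY Pab; have mab : measurable (Y @^-1` `[a, b]%classic).
  by rewrite -[X in measurable X]setTI; exact: mY.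
have aeab : {ae P, forall w, `[a, b]%classic (Y w)}.
  exists (~` (Y @^-1` `[a, b]%classic)); split => //; first exact: measurableC.
  by rewrite probability_setC// Pab subee.
have YL : Y \in Lfun P +oo%E.
  apply/andP; split; rewrite inE//=.
  rewrite /finite_norm unlock/= probability_setT lte01.
  apply: (@le_lt_trans _ _ (`|a| + `|b|)%:E); last exact: ltry.
  apply/ess_supP; apply: filterS aeab => w; rewrite /= in_itv/= lee_fin => /andP[aY Yb].
  have := ler_norm (- a); have := ler_norm b; rewrite normrN.
  have := normr_ge0 a; have := normr_ge0 b; rewrite ler_norml; lra.
by exists (Lfun_Sub (leey _) YL).
Qed.

(** * Convergence of the loss laws and of their risks *)

Theorem theorem4p14 (R : realType) (T : polishType R) (reg : regime R)
    (dO : nat -> measure_display) (Om : forall n, measurableType (dO n))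
    (Pr : forall n, probability (Om n) R)
    (net : forall n, Om n -> mgraph T reg 'I_n.+1)
    (dL : measure_display) (OL : measurableType dL) (PL : probability OL R)
    (X : {mfun OL >-> Borel (Gstar T reg)})
    (x : forall n, Om n -> 'I_n.+1 -> R) (xo : {RV PL >-> R})
    (Kx : set R) (l : T * R -> R)
    (hnet : forall n, measurable_network (net n))
    (hreg : regime_hypotheses Pr net PL X)
    (hx : equilibrium_selection net x)
    (hxo : limit_equilibrium X xo)
    (hrisk : bounded_risk_domain Pr net PL X Kx l) :
  let eta_ n (w : Om n) : Rlaw R := finite_loss_law net l x w in
  let Yo : OL -> R := limit_loss X l xo in
  let eta : Rlaw R := law PL Yo in
  weak_cvg_in_prob Pr (bcontinuous R R) eta_ eta /\
  forall (a b : R) (D : set (Rlaw R)) (vrho : Rlaw R -> R),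
    (forall t z, Kx z -> a <= l (t, z) <= b) ->
    D `<=` [set mu | mu `[a, b]%classic = 1%E] ->
    weak_continuity Pr D vrho eta_ eta ->
    cvg_in_prob Pr (fun n w => vrho (eta_ n w)) (vrho eta) /\
    forall rho : Linfty PL -> R,
      atomless PL -> law_invariant rho -> law_representation rho D vrho ->
      exists2 Y : Linfty PL, Y =1 Yo & vrho eta = rho Y.
Proof.
move=> eta_ Yo eta.
have [mb cl _] := hrisk.
have [lo [hi [loL hiL fin_s lim_s]]] := regime_sandwich hx hxo mb.
have PnP : local_convergence Pr net PL X.
  by clear -hreg; destruct reg; case: hreg.
have mYo : measurable_fun setT Yo by exact: measurable_limit_loss.
have upper h e : bcontinuous R R h -> 0 < e -> vanishing Pr (fun n => [set w |
    e <= \int[eta_ n w]_y h y - \int[eta]_y h y]).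
  move=> bh e0; rewrite (Rintegral_law _ mYo bh).
  exact: (loss_integral_upper cl loL hiL fin_s lim_s PnP).
have weak : weak_cvg_in_prob Pr (bcontinuous R R) eta_ eta.
  move=> h bh e e0; have [ch [M hM]] := bh.
  (* the lower bound for [h] is the upper bound for its opposite *)
  have bNh : bcontinuous R R (fun y => - h y).
    split; first by move=> y; apply: cvgN; exact: ch.
    by exists M => y; rewrite normrN.
  have intN (mu : Rlaw R) : \int[mu]_y - h y = - \int[mu]_y h y.
    have ih : mu.-integrable setT (EFin \o h).
      by apply: bounded_integrable; [exact: continuous_measurable_fun|exists M].
    rewrite -mulN1r -RintegralZl//; apply: eq_Rintegral => y _.
    by rewrite mulN1r.
  apply: vanishing_sub (vanishingU (upper h e bh e0) (upper _ e bNh e0)) => n w /=.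
  rewrite !intN opprK addrC -normrN.
  by rewrite ler_normr => /orP[]; [right|left]; lra.
split=> // a b D vrho _ Dab [Deta_ Deta vc _]; split.
  move=> e e0.
  have near_eta : nbhs (eta : weak_law R) [set mu | D mu -> `|vrho mu - vrho eta| < e].
    by have /cvgrPdist_lt/(_ e e0) := vc; apply: filterS => mu; rewrite distrC.
  apply: vanishing_sub (vanishingU (nbhs_weak_law_vanishing weak near_eta)
    (vanishing_ae (E := fun n => [set w | ~ D (eta_ n w)]) _)) => [n w /= ew|n].
    have [Dw|nDw] := pselect (D (eta_ n w)); [left => /(_ Dw)|by right].
    by rewrite ltNge ew.
  by apply: filterS (Deta_ n) => w Dw /=; exact.
move=> rho _ _ rhoE.
(* loss laws charge only [[a, b]], so the limiting loss defines an element of [Linfty] *)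
have Pab : PL (Yo @^-1` `[a, b]%classic) = 1%E.
  by rewrite -law_setE//; exact: Dab.
have [Y YYo] := ae_bounded_Linfty mYo Pab; exists Y => //.
apply/esym/rhoE => // B mB; rewrite /eta; congr (law PL _ B).
by apply/esym/funext.
Qed.
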